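(* For $I\in\mathcal I_\lambda$ and $i=1,\dots,N-1$, $$\Bigl(\sum_{j=1}^{\lambda^{(i)}}t^{(i)}_j-\sum_{j=1}^{\lambda^{(i-1)}}t^{(i-1)}_j-\sum_{a\in I_i}z_a\Bigr)W_I=h\sum_{j=1}^{i-1}\sum_{m_1=1}^{\lambda_i}\sum_{\substack{m_2=1\\ \ell_{i,m_1}>\ell_{j,m_2}}}^{\lambda_j}W_{I_{i,j;m_1,m_2}}-h\sum_{j=i+1}^N\sum_{m_1=1}^{\lambda_i}\sum_{\substack{m_2=1\\ \ell_{i,m_1}<\ell_{j,m_2}}}^{\lambda_j}W_{I_{i,j;m_1,m_2}}$$ $$\qquad+\sum_{j=i+1}^N\sum_{a=1}^{\lambda_i}\check d_{\{i,j\}}U_{(I)^a_{i,j}}-\sum_{j=1}^{i-1}\sum_{a=1}^{\lambda_j}\check d_{\{j,i\}}U_{(I)^a_{j,i}}.$$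
   Context: Fix positive integers $N,n$ and $h\in\mathbb C^\times$. For $\lambda=(\lambda_1,\dots,\lambda_N)\in\mathbb Z_{\ge0}^N$ with $\lambda_1+\dots+\lambda_N=n$ put $\lambda^{(i)}=\lambda_1+\dots+\lambda_i$, $\lambda^{(0)}=0$; $\mathcal I_\lambda$ is the set of ordered partitions $I=(I_1,\dots,I_N)$ of $\{1,\dots,n\}$ into disjoint subsets with $|I_j|=\lambda_j$. Variables: $t=(t^{(j)}_a)$, $1\le j\le N-1$, $1\le a\le\lambda^{(j)}$; $t^{(N)}_a=z_a$, $1\le a\le n$. $\mathrm{Sym}_{x_1,\dots,x_k}f=\sum_{\sigma\in S_k}f(x_{\sigma(1)},\dots,x_{\sigma(k)})$; $\mathrm{Sym}_t=\mathrm{Sym}_{t^{(1)}_1,\dots,t^{(1)}_{\lambda^{(1)}}}\cdots\mathrm{Sym}_{t^{(N-1)}_1,\dots,t^{(N-1)}_{\lambda^{(N-1)}}}$. Empty products equal 1, empty sums 0. For $I\in\mathcal I_\lambda$ write $I_1\cup\dots\cup I_j=\{i^{(j)}_1<\dots<i^{(j)}_{\lambda^{(j)}}\}$ and $$U_I(t;z)=\prod_{j=1}^{N-1}\prod_{a=1}^{\lambda^{(j)}}\Bigl(\prod_{c:\,i^{(j+1)}_c<i^{(j)}_a}(t^{(j)}_a-t^{(j+1)}_c)\prod_{d:\,i^{(j+1)}_d>i^{(j)}_a}(t^{(j)}_a-t^{(j+1)}_d-h)\prod_{b=a+1}^{\lambda^{(j)}}\frac{t^{(j)}_b-t^{(j)}_a-h}{t^{(j)}_b-t^{(j)}_a}\Bigr)$$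 ($c,d\in\{1,\dots,\lambda^{(j+1)}\}$), and $W_I=\mathrm{Sym}_t\,U_I$. Write $I_k=\{\ell_{k,1}<\dots<\ell_{k,\lambda_k}\}$. For $i\ne j$, $I_{i,j;m_1,m_2}\in\mathcal I_\lambda$ is obtained from $I$ by exchanging $\ell_{i,m_1}\in I_i$ with $\ell_{j,m_2}\in I_j$. $(I)^a_{i,j}$ is obtained from $I$ by moving the element $\ell_{i,a}$ from $I_i$ to $I_j$; it belongs to $\mathcal I_{\lambda_{i,j}}$, where $\lambda_{\alpha,\beta}$ is $\lambda$ with $\lambda_\alpha$ replaced by $\lambda_\alpha-1$ and $\lambda_\beta$ by $\lambda_\beta+1$. For $\alpha<\beta$ let $t_{\{\alpha,\beta\}}$ be the collection $t$ with the variables $t^{(i)}_{\lambda^{(i)}}$, $\alpha\le i<\beta$, removed. For $J\in\mathcal I_{\lambda_{\alpha,\beta}}$, $U_J$ (the formula above with $\lambda$ replaced by $\lambda_{\alpha,\beta}$) is a function of $t_{\{\alpha,\beta\}},z$. For a rational function $g$ of $t_{\{\alpha,\beta\}},z$ put $\check d_{\{\alpha,\beta\}}g=\mathrm{Sym}_t\bigl(g\cdot B_{\alpha,\beta}\bigr)$, where $$B_{\alpha,\beta}=(t^{(\alpha-1)}_{\lambda^{(\alpha-1)}}-t^{(\alpha)}_{\lambda^{(\alpha)}}-h)\prod_{i=\alpha}^{\beta-1}\prod_{a=1}^{\lambda^{(i-1)}-1}(t^{(i-1)}_a-t^{(i)}_{\lambda^{(i)}}-h)\cdot(t^{(\beta-1)}_{\lambda^{(\beta-1)}}-t^{(\beta)}_{\lambda^{(\beta)}})\prod_{i=\alpha}^{\beta-1}\prod_{a=1}^{\lambda^{(i+1)}-1}(t^{(i)}_{\lambda^{(i)}}-t^{(i+1)}_a)\prod_{i=\alpha}^{\beta-1}\prod_{a=1}^{\lambda^{(i)}-1}\frac{t^{(i)}_{\lambda^{(i)}}-t^{(i)}_a-h}{t^{(i)}_{\lambda^{(i)}}-t^{(i)}_a},$$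 with the convention that the factor containing $t^{(\alpha-1)}_{\lambda^{(\alpha-1)}}$ is replaced by 1 if $\lambda^{(\alpha-1)}=0$ (in particular if $\alpha=1$). *)

(* Defs.v *)
From mathcomp Require Import all_boot all_order all_fingroup all_algebra.
From mathcomp Require Import complex reals.
From mathcomp Require Import mpoly.

Set Implicit Arguments.
Unset Strict Implicit.
Unset Printing Implicit Defensive.

Import GRing.Theory.
Local Open Scope ring_scope.

(* Conventions.  The parts of a composition or of an ordered partition are
   indexed from 0 by 'I_N and the partitioned set {1, ..., n} is 'I_n, so that
   the part k : 'I_N is the part number k.+1 of the mathematical text.  Levels
   (the superscripts in lambda^(j) and t^(j)) keep their values 0, ..., N.
   Subscripts start at 0: t j a is t^(j)_(a+1), and the last variable of level
   j is t j (psum lam j).-1. *)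

Section Combinatorics.
Variables N n : nat.
Implicit Types (lam : {ffun 'I_N -> nat}) (I : {ffun 'I_N -> {set 'I_n}}).

(* lambda^(m) *)
Definition psum lam (m : nat) : nat := (\sum_(k < N | k < m) lam k)%N.

(* membership in I_lambda *)
Definition ordered_partition lam I : bool :=
  [&& [forall k, #|I k| == lam k],
      [forall k, forall l, (k != l) ==> [disjoint I k & I l]]
    & \bigcup_k I k == [set: 'I_n]].

(* The entry number a (from 0) of A listed increasingly; 0 if a >= #|A|. *)
Definition entry (A : {set 'I_n}) (a : nat) : nat :=
  nth 0%N [seq val x | x <- enum A] a.

(* i^(j)_(a+1) *)
Definition iel I (j a : nat) : nat :=
  entry (\bigcup_(k < N | (k < j)%N) I k) a.

(* ell_(k, a+1) *)
Definition ell I (k : 'I_N) (a : nat) : nat := entry (I k) a.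

Definition point (p : nat) : {set 'I_n} := [set x | val x == p].

(* I_(i, j; m1, m2) *)
Definition exchange I (i j : 'I_N) (m1 m2 : nat) : {ffun 'I_N -> {set 'I_n}} :=
  [ffun k => if k == i then I i :\: point (ell I i m1) :|: point (ell I j m2)
             else if k == j
                  then I j :\: point (ell I j m2) :|: point (ell I i m1)
                  else I k].

(* (I)^a_(i, j) *)
Definition move I (i j : 'I_N) (a : nat) : {ffun 'I_N -> {set 'I_n}} :=
  [ffun k => if k == i then I i :\: point (ell I i a)
             else if k == j then I j :|: point (ell I i a)
             else I k].

(* lambda_(al, be) *)
Definition shift lam (al be : 'I_N) : {ffun 'I_N -> nat} :=
  [ffun k => if k == al then (lam al).-1
             else if k == be then (lam be).+1
             else lam k].

End Combinatorics.

Section WeightFunctions.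
Variables (K : fieldType) (h : K) (N n : nat).
Implicit Types (lam : {ffun 'I_N -> nat}) (I : {ffun 'I_N -> {set 'I_n}}).

(* Values for all the variables t^(j)_a, with z_a = t^(N)_a. *)
Definition assignment := nat -> nat -> K.
Implicit Types (t : assignment) (f g : assignment -> K).

Definition U lam I t : K :=
  \prod_(1 <= j < N) \prod_(a < psum lam j)
    ((\prod_(c < psum lam j.+1 | (iel I j.+1 c < iel I j a)%N)
        (t j a - t j.+1 c))
     * (\prod_(d < psum lam j.+1 | (iel I j a < iel I j.+1 d)%N)
          (t j a - t j.+1 d - h))
     * (\prod_(b < psum lam j | (a < b)%N)
          ((t j b - t j a - h) / (t j b - t j a)))).

Definition permute (j k : nat) (s : 'S_k) t : assignment :=
  fun j' a => if j' == j then
                if (insub a : option 'I_k) is Some b then t j (s b) else t j a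
              else t j' a.

(* Sym in the first k variables of level j *)
Definition Sym1 (j k : nat) f : assignment -> K :=
  fun t => \sum_(s : 'S_k) f (permute j s t).

(* Sym_t : levels 1, ..., N-1 *)
Definition Sym lam f : assignment -> K :=
  foldr (fun j g => Sym1 j (psum lam j) g) f (iota 1 N.-1).

Definition W lam I : assignment -> K := Sym lam (U lam I).

(* B_(al, be), where al < be are the 1-based part numbers *)
Definition B lam (al be : nat) t : K :=
  let p := psum lam in
  let last j := t j (p j).-1 in
  (if p al.-1 == 0%N then 1 else last al.-1 - last al - h)
  * (\prod_(al <= i < be) \prod_(a < (p i.-1).-1) (t i.-1 a - last i - h))
  * (last be.-1 - last be)
  * (\prod_(al <= i < be) \prod_(a < (p i.+1).-1) (last i - t i.+1 a))
  * (\prod_(al <= i < be) \prod_(a < (p i).-1)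
       ((last i - t i a - h) / (last i - t i a))).

(* g is meant to depend only on the variables other than the last ones of the
   levels al.+1, ..., be. *)
Definition dcheck lam (al be : 'I_N) g : assignment -> K :=
  Sym lam (fun t => g t * B lam al.+1 be.+1 t).

End WeightFunctions.

Section Generic.
Variables (F : fieldType) (N : nat) (lam : {ffun 'I_N -> nat}).

(* One index for each variable t^(j)_a with j = 0, ..., N and
   a = 1, ..., lambda^(j); there is none at level 0. *)
Definition var_index := {j : 'I_N.+1 & 'I_(psum lam j)}.

(* The assignment of the variables t^(j)_a themselves, as elements of the field
   of rational functions; 0 for out of range indices. *)
Definition tvar : assignment {fraction {mpoly F[#|{: var_index}|]}} :=
  fun j a =>
    if (insub j : option 'I_N.+1) is Some j' then
      if (insub a : option 'I_(psum lam j')) is Some a' then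
        tofrac 'X_(enum_rank (Tagged (fun j'' : 'I_N.+1 => 'I_(psum lam j'')) a'
                               : var_index))
      else 0
    else 0.

Definition ratconst (c : F) : {fraction {mpoly F[#|{: var_index}|]}} :=
  tofrac c%:MP.

End Generic.

(* Main.v *)
Require Import Defs.
From mathcomp Require Import all_boot all_order all_fingroup all_algebra.
From mathcomp Require Import complex reals.
From mathcomp Require Import mpoly.
From mathcomp Require Import boolp ring zify.

Set Implicit Arguments.
Unset Strict Implicit.
Unset Printing Implicit Defensive.

Import GRing.Theory.
Local Open Scope ring_scope.

(** An element x of the part I_k owns one variable at each level j >= k, the
    last of them being z_x at level N.  Indexed in this way by elements instead
    of subscripts, U_I is a product over pairs of elements in which only their
    relative order matters, and the factor that compares a variable of level j
    with one of level j+1 is absent exactly when both belong to the same element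
    ([U_weight]).

    The multiplier on the left-hand side telescopes into differences of
    consecutive variables of one element x ([multiplier_telescope]), and such a
    difference is the factor that was absent: multiplying U_I by it amounts to
    cutting the chain of variables of x in two and declaring that the lower
    piece belongs to a new element, placed immediately after x ([weight_start]).
    Now move this new element to the right, past all the elements y > x.  Once
    it lies beyond all of them, the product is the integrand of the operator
    which moves x to another part ([dcheck_integrand]).  Passing y changes the
    symmetrized product only if the chain of y starts at the level just above
    the cut; then the product changes by h times its value when the new element
    sits on y itself, and there the lower piece of x is glued to the chain of y,
    which is the effect of exchanging x and y ([weight_cross_at], [weight_at]).
    Summing over y gives the symmetrization of one difference times U_I
    ([chain_relation]); summing over the differences gives the theorem.

    If the chain of y starts higher, no factor compares it with the moving
    piece.  What remains is the case where it starts lower and runs alongside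
    that piece ([symL_weight_cross_below]).  Swapping the two variables at all the common
    levels makes the products before and after the passage agree except at the
    two ends, so their difference is a common product, the ladder, times a
    bracket that involves the end levels only.  The bracket is a combination of
    two rungs u - s + h, where s and u are the variables of the moving element
    and of y at the lowest or at the highest common level.  A ladder times a
    rung at one of its ends symmetrizes to zero: symmetrizing the level at the
    opposite end leaves a function that is symmetric in the next level
    ([exchange_up], [exchange_down]), which shortens the ladder, and for a
    single level the product is antisymmetric. *)

(** * Symmetrization as a linear functional *)

Section Symmetrization.
Variables (K : fieldType) (N : nat) (lam : {ffun 'I_N -> nat}).
Implicit Types (t : assignment K) (f g : assignment K -> K) (r : seq nat).
Notation p := (psum lam).
Notation sym_on := (foldr (fun j f => Sym1 j (p j) f)).

Definition permute_levels (s : forall j, 'S_(p j)) r t : assignment K :=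
  fun j a => if j \in r then permute j (s j) t j a else t j a.

Lemma permute_comp j k (s s' : 'S_k) t :
  permute j s (permute j s' t) = permute j (s * s')%g t.
Proof.
apply: funext => j'; apply: funext => a; rewrite /permute eqxx.
case: eqP => // _; case: insubP => //= b _ eq_b.
by rewrite valK permM.
Qed.

Lemma permute_commute j j' k k' (s : 'S_k) (s' : 'S_k') t : j != j' ->
  permute j s (permute j' s' t) = permute j' s' (permute j s t).
Proof.
move=> neq_jj'; apply: funext => m; apply: funext => a; rewrite /permute.
rewrite [j' == j]eq_sym (negbTE neq_jj').
by case: (eqVneq m j) => [->|] //; rewrite (negbTE neq_jj').
Qed.

Lemma sym_on_eq r f g : f =1 g -> sym_on f r =1 sym_on g r.
Proof. by move/funext->. Qed.

Lemma sym_on_permute_out r f j (s : 'S_(p j)) t : j \notin r ->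
  sym_on (f \o permute j s) r t = sym_on f r (permute j s t).
Proof.
elim: r t => //= j' r IHr t; rewrite inE negb_or => /andP[neq_jj' r'j].
apply: eq_bigr => s' _; rewrite IHr //.
by rewrite permute_commute.
Qed.

Lemma sym_on_permute_levels r f s : uniq r ->
  sym_on (f \o permute_levels s r) r =1 sym_on f r.
Proof.
elim: r f => [|j r IHr] f //= /andP[r'j uniq_r] t.
have -> : f \o permute_levels s (j :: r)
        = (f \o permute j (s j)) \o permute_levels s r.
  apply: funext => t' /=; congr (f _).
  apply: funext => j'; apply: funext => a; rewrite /permute_levels /permute inE.
  case: eqP => [->|] //=; rewrite (negbTE r'j) eqxx.
  by case: insubP.
rewrite /Sym1 (reindex_inj (mulgI (s j)^-1%g)).
apply: eq_bigr => s' _; rewrite IHr // sym_on_permute_out //.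
by rewrite permute_comp mulKVg.
Qed.

Lemma sym_on_ext (Q : assignment K -> Prop) r f g t :
    (forall j (s : 'S_(p j)) t', j \in r -> Q t' -> Q (permute j s t')) ->
    (forall t', Q t' -> f t' = g t') -> Q t -> sym_on f r t = sym_on g r t.
Proof.
move=> clQ eq_fg; elim: r t clQ => [|j r IHr] t clQ Qt /=; first exact: eq_fg.
apply: eq_bigr => s _; apply: IHr => [j' s' t' r_j'|].
  by apply: clQ; rewrite inE r_j' orbT.
by apply: clQ; rewrite ?mem_head.
Qed.

Lemma sym_on_add r f g t :
  sym_on (fun t => f t + g t) r t = sym_on f r t + sym_on g r t.
Proof.
elim: r t => //= j r IHr t; rewrite -big_split /=.
by apply: eq_bigr => s _; rewrite IHr.
Qed.

Lemma sym_on_mul_invariant r (c : assignment K -> K) f t :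
    (forall j (s : 'S_(p j)) t', j \in r -> c (permute j s t') = c t') ->
  sym_on (fun t => c t * f t) r t = c t * sym_on f r t.
Proof.
elim: r t => //= j r IHr t cinv.
rewrite [Sym1 j (p j) _ _ in RHS]/Sym1 mulr_sumr.
apply: eq_bigr => s _; rewrite IHr ?cinv ?mem_head // => j' s' t' r_j'.
by rewrite cinv // inE r_j' orbT.
Qed.

Lemma mem_levels j : (j \in iota 1 N.-1) = (0 < j < N)%N.
Proof. by rewrite mem_iota; case: N => [|m]; case: j => [|j]; rewrite ?andbF. Qed.

Lemma Sym_permute_levels f s t :
  Defs.Sym lam (f \o permute_levels s (iota 1 N.-1)) t = Defs.Sym lam f t.
Proof. by apply: sym_on_permute_levels; apply: iota_uniq. Qed.

(** Used with Q the absence of collisions between variables of one level: the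
    identities between rational functions below hold away from their poles. *)
Lemma Sym_ext (Q : assignment K -> Prop) f g t :
    (forall j (s : 'S_(p j)) t', (0 < j < N)%N -> Q t' -> Q (permute j s t')) ->
    (forall t', Q t' -> f t' = g t') -> Q t ->
  Defs.Sym lam f t = Defs.Sym lam g t.
Proof.
move=> clQ; apply: sym_on_ext => j s t'; rewrite mem_levels; exact: clQ.
Qed.

Lemma Sym_eq f g t : f =1 g -> Defs.Sym lam f t = Defs.Sym lam g t.
Proof. by move=> eq_fg; apply: sym_on_eq. Qed.

Lemma Sym_add f g t :
  Defs.Sym lam (fun t => f t + g t) t = Defs.Sym lam f t + Defs.Sym lam g t.
Proof. exact: sym_on_add. Qed.

(** This brings the symmetric multiplier of the theorem under the sum. *)
Lemma Sym_mul_invariant (c : assignment K -> K) f t :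
    (forall j (s : 'S_(p j)) t', (0 < j < N)%N -> c (permute j s t') = c t') ->
  Defs.Sym lam (fun t => c t * f t) t = c t * Defs.Sym lam f t.
Proof.
move=> cinv; apply: sym_on_mul_invariant => j s t'; rewrite mem_levels.
exact: cinv.
Qed.

Lemma Sym_scale (c : K) f t :
  Defs.Sym lam (fun t => c * f t) t = c * Defs.Sym lam f t.
Proof. by rewrite (Sym_mul_invariant (c := fun=> c)). Qed.

Lemma Sym_opp f t : Defs.Sym lam (fun t => - f t) t = - Defs.Sym lam f t.
Proof.
rewrite -mulN1r -Sym_scale; apply: Sym_eq => t'; by rewrite mulN1r.
Qed.

Lemma Sym0 t : Defs.Sym lam (fun=> 0) t = 0.
Proof.
by rewrite -[RHS](mul0r (Defs.Sym lam (fun=> 0) t)) -Sym_scale;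
   apply: Sym_eq => t'; rewrite mul0r.
Qed.

Lemma Sym_sum (J : Type) (r : seq J) (P : pred J) (F : J -> assignment K -> K) t :
  Defs.Sym lam (fun t => \sum_(x <- r | P x) F x t) t
  = \sum_(x <- r | P x) Defs.Sym lam (F x) t.
Proof.
elim: r => [|x r IHr].
  by rewrite big_nil -[RHS](Sym0 t); apply: Sym_eq => t'; rewrite big_nil.
rewrite big_cons -IHr; case: (boolP (P x)) => Px; rewrite -?Sym_add;
  by apply: Sym_eq => t'; rewrite big_cons ?Px ?(negbTE Px).
Qed.

Lemma sum_level_permute j k (s : 'S_k) m t :
  (m != j) || (k == p m) ->
  \sum_(a < p m) permute j s t m a = \sum_(a < p m) t m a.
Proof.
case: eqVneq => [->|neq_mj _] /=; last first.
  by apply: eq_bigr => a _; rewrite /permute (negbTE neq_mj).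
move=> /eqP eq_k; case: _ / eq_k in s *.
rewrite [RHS](reindex_inj (@perm_inj _ s)); apply: eq_bigr => a _.
by rewrite /permute eqxx valK.
Qed.

End Symmetrization.

(** * Variables indexed by labels *)

Section Labels.
Variables (K : fieldType) (N : nat) (lam : {ffun 'I_N -> nat}).
Implicit Types (t : assignment K) (L : nat -> seq nat).

(** The labels are natural numbers; the list L j says which label each of the
    variables of level j carries. *)
Definition labelled L t : nat -> nat -> K := fun j q => t j (index q (L j)).

Lemma relabel_perm k (l l' : seq nat) (r : nat -> nat) :
    size l = k -> uniq l' -> perm_eq (map r l) l' ->
  exists s : 'S_k, forall q (lt_q : (index q l < k)%N),
    index (r q) l' = s (Ordinal lt_q).
Proof.
move=> size_l uniq_l' eq_rl; have size_l' : size l' == k.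
  by rewrite -(perm_size eq_rl) size_map size_l.
have /tuple_permP[s eq_s] := eq_rl : perm_eq _ (Tuple size_l').
exists s => q lt_q; have lq : q \in l by rewrite -index_mem size_l.
rewrite -(index_uniq 0%N (i := s (Ordinal lt_q)) _ uniq_l') ?(eqP size_l') //.
congr (index _ _).
have := congr1 (fun v => nth 0%N v (index q l)) eq_s.
rewrite (nth_map 0%N) ?index_mem // nth_index // => ->.
by rewrite -[X in nth _ _ X]/(val (Ordinal lt_q)) nth_mktuple (tnth_nth 0%N).
Qed.

(** Listing the labels of a level in another order, or renaming them, permutes
    the variables of that level, which symmetrization does not see. *)
Lemma Sym_relabel L L' (r : nat -> nat -> nat) (F : (nat -> nat -> K) -> K) t :
    (forall j, (0 < j < N)%N -> size (L j) = psum lam j) ->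
    (forall j, (0 < j < N)%N -> uniq (L' j)) ->
    (forall j, (0 < j < N)%N -> perm_eq (map (r j) (L j)) (L' j)) ->
    (forall q, q \in L N -> index q (L N) = index (r N q) (L' N)) ->
    (forall v v', (forall j q, (0 < j <= N)%N -> q \in L j -> v j q = v' j q) ->
       F v = F v') ->
  Defs.Sym lam (F \o labelled L) t
  = Defs.Sym lam (fun t => F (fun j q => labelled L' t j (r j q))) t.
Proof.
move=> size_L uniq_L' eq_rL eq_top F_local.
have exs j : {s : 'S_(psum lam j) | (0 < j < N)%N ->
    forall q (lt_q : (index q (L j) < psum lam j)%N),
    index (r j q) (L' j) = s (Ordinal lt_q)}.
  apply: cid; case: (boolP (0 < j < N)%N) => [j_in|]; last by exists 1%g.
  have [s sP] := relabel_perm (size_L _ j_in) (uniq_L' _ j_in) (eq_rL _ j_in).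
  by exists s.
pose s j := projT1 (exs j).
have sP j : (0 < j < N)%N -> forall q (lt_q : (index q (L j) < psum lam j)%N),
    index (r j q) (L' j) = s j (Ordinal lt_q) by exact: (projT2 (exs j)).
rewrite -(Sym_permute_levels _ s); move: s sP => s sP {exs}.
apply: Sym_eq => t' /=; apply: F_local => j q j_in Lq.
rewrite /labelled /permute_levels mem_levels.
case: (ltnP j N) => [lt_jN|le_Nj]; last first.
  have eq_jN : j = N by apply/eqP; rewrite eqn_leq le_Nj andbT; case/andP: j_in.
  by rewrite eq_jN in Lq *; rewrite andbF -eq_top.
have j_in' : (0 < j < N)%N by rewrite lt_jN andbT; case/andP: j_in.
have lt_q : (index q (L j) < psum lam j)%N by rewrite -size_L ?index_mem.
rewrite (sP j j_in' q lt_q) /permute eqxx.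
by case/andP: j_in => -> _; rewrite /= insubT.
Qed.

End Labels.

(** * Products over pairs of labels *)

Section Weight.
Variables (K : fieldType) (h : K) (N : nat).

(** Labels at equal positions contribute no factor, as the two variables of one
    element at consecutive levels do in U_I. *)
Definition cross_weight (p q : nat) (z : K) :=
  if (q < p)%N then z else if (p < q)%N then z - h else 1.

Definition inner_weight (p q : nat) (z : K) :=
  if (p < q)%N then (z - h) / z else 1.

Definition label_product (L : nat -> seq nat) (cw iw : nat -> nat -> K -> K)
    (v : nat -> nat -> K) : K :=
  \prod_(1 <= j < N)
    ((\prod_(p <- L j) \prod_(q <- L j.+1) cw p q (v j p - v j.+1 q))
     * \prod_(p <- L j) \prod_(q <- L j) iw p q (v j q - v j p)).

(** The order of the labels is that of their positions, so that a label can be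
    moved without touching its variables. *)
Definition weight L (pos : nat -> nat) :=
  label_product L (fun p q => cross_weight (pos p) (pos q))
                  (fun p q => inner_weight (pos p) (pos q)).

End Weight.

(** * Moving a label past another one *)

Section Exchange.
Variables (K : fieldType) (h : K) (N : nat) (lam : {ffun 'I_N -> nat}).
(* o is the label that moves and y the one that it passes. *)
Variables (L : nat -> seq nat) (o y : nat) (t0 : assignment K).
Hypothesis L_uniq : forall j, (0 < j < N)%N -> uniq (L j).
Hypothesis L_size : forall j, (0 < j < N)%N -> size (L j) = psum lam j.
Hypothesis t0_distinct : forall j a b, (0 < j < N)%N ->
  (a < psum lam j)%N -> (b < psum lam j)%N -> a != b -> t0 j a != t0 j b.
Hypothesis two_neq0 : 2%:R != 0 :> K.
Hypothesis neq_oy : o != y.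
Implicit Types (v : nat -> nat -> K) (F G : (nat -> nat -> K) -> K).

Definition shared j : bool := [&& (0 < j < N)%N, o \in L j & y \in L j].

Definition separated v :=
  forall j, shared j -> v j o != v j y.

Definition swap_label (q : nat) := if q == o then y else if q == y then o else q.

Definition swap (Q : pred nat) v : nat -> nat -> K :=
  fun j q => if Q j then v j (swap_label q) else v j q.

Definition symL F : K := Defs.Sym lam (F \o labelled L) t0.

Lemma symL_ext F G : (forall v, separated v -> F v = G v) -> symL F = symL G.
Proof.
move=> eqFG.
pose Q (t : assignment K) := forall j a b, (0 < j < N)%N ->
  (a < psum lam j)%N -> (b < psum lam j)%N -> a != b -> t j a != t j b.
apply: (@Sym_ext _ _ _ Q) => // [j s t j_in Qt j' a b j_in' lt_a lt_b neq_ab|t Qt].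
  rewrite /permute; case: (eqVneq j' j) => [eq_j|_]; last exact: Qt.
  rewrite eq_j in lt_a lt_b *; rewrite !insubT /=.
  by apply: Qt => //; rewrite (inj_eq val_inj) (inj_eq perm_inj).
apply: eqFG => j /and3P[j_in oL yL]; apply: Qt => //; rewrite -?L_size ?index_mem //.
apply: contra neq_oy => /eqP eq_ind; apply/eqP.
by rewrite -(nth_index 0%N oL) eq_ind nth_index.
Qed.

Lemma symL_add F G : symL (fun v => F v + G v) = symL F + symL G.
Proof. exact: Sym_add. Qed.

Lemma symL_sub F G : symL (fun v => F v - G v) = symL F - symL G.
Proof. by rewrite -[in RHS]Sym_opp -Sym_add. Qed.

Lemma symL_scale c F : symL (fun v => c * F v) = c * symL F.
Proof. exact: Sym_scale. Qed.

Lemma swap_labelK : involutive swap_label.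
Proof.
move=> q; rewrite /swap_label; case: (eqVneq q o) => [->|neq_qo].
  by rewrite eqxx eq_sym (negbTE neq_oy).
case: (eqVneq q y) => [->|neq_qy]; first by rewrite eqxx.
by rewrite (negbTE neq_qo) (negbTE neq_qy).
Qed.

Lemma swap_label_id q : q != o -> q != y -> swap_label q = q.
Proof. by rewrite /swap_label => /negbTE-> /negbTE->. Qed.

Lemma swap_label_o : swap_label o = y.
Proof. by rewrite /swap_label eqxx. Qed.

Lemma swap_label_y : swap_label y = o.
Proof. by rewrite /swap_label eqxx eq_sym (negbTE neq_oy). Qed.

Lemma swap_o Q v j : swap Q v j o = if Q j then v j y else v j o.
Proof. by rewrite /swap swap_label_o. Qed.

Lemma swap_y Q v j : swap Q v j y = if Q j then v j o else v j y.
Proof. by rewrite /swap swap_label_y. Qed.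

Lemma perm_swap_label l : uniq l -> o \in l -> y \in l ->
  perm_eq (map swap_label l) l.
Proof.
move=> uniq_l ol yl; apply: uniq_perm => //.
  by rewrite map_inj_uniq //; apply: inv_inj swap_labelK.
move=> q; rewrite -{1}[q]swap_labelK mem_map; last exact: inv_inj swap_labelK.
rewrite /swap_label; case: eqVneq => [->|_]; first by rewrite ol yl.
by case: eqVneq => // ->; rewrite ol yl.
Qed.

Lemma symL_swap (Q : pred nat) F : {subset Q <= shared} ->
  symL (F \o swap Q) = symL F.
Proof.
move=> Qsh.
have exs j : {s : 'S_(psum lam j) | (Q j ->
    forall q (lt_q : (index q (L j) < psum lam j)%N),
    index (swap_label q) (L j) = s (Ordinal lt_q)) /\ (~~ Q j -> s = 1%g)}.
  apply: cid; case: (boolP (Q j)) => [Qj|]; last by exists 1%g.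
  have /and3P[j_in oL yL] := Qsh j Qj.
  have [s sP] := relabel_perm (L_size j_in) (L_uniq j_in)
                   (perm_swap_label (L_uniq j_in) oL yL).
  by exists s.
pose s j := projT1 (exs j).
have sP j : Q j -> forall q (lt_q : (index q (L j) < psum lam j)%N),
    index (swap_label q) (L j) = s j (Ordinal lt_q) := (projT2 (exs j)).1.
have s1 j : ~~ Q j -> s j = 1%g := (projT2 (exs j)).2.
rewrite /symL -[RHS](Sym_permute_levels _ s); move: s sP s1 => s sP s1 {exs}.
apply: Sym_eq => t /=; congr (F _); apply: funext => j; apply: funext => q.
rewrite /swap /labelled /permute_levels mem_levels /permute eqxx.
case: (boolP (Q j)) => [Qj|/s1->]; last first.
  by case: ifP => // _; case: insubP => // a _ <-; rewrite perm1.
have /and3P[j_in oL yL] := Qsh j Qj; rewrite j_in.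
case: insubP => [a lt_a eq_a|]; last first.
  rewrite -L_size // index_mem => notLq.
  rewrite swap_label_id //; last by apply: contraNneq notLq => ->.
  by apply: contraNneq notLq => ->.
rewrite (sP j Qj q lt_a); congr (t j (s j _)).
exact: val_inj.
Qed.

Lemma symL_average (Q : pred nat) F : {subset Q <= shared} ->
  2%:R * symL F = symL (fun v => F v + F (swap Q v)).
Proof.
by move=> Qsh; rewrite symL_add (symL_swap F Qsh) mulr_natl mulr2n.
Qed.

Lemma symL0 : symL (fun=> 0) = 0.
Proof. exact: Sym0. Qed.

Lemma symL_antisym (Q : pred nat) F : {subset Q <= shared} ->
  (forall v, separated v -> F (swap Q v) = - F v) -> symL F = 0.
Proof.
move=> Qsh anti; apply: (mulfI two_neq0); rewrite (symL_average F Qsh) mulr0.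
rewrite -[RHS]symL0; apply: symL_ext => v sep_v.
by rewrite anti // subrr.
Qed.

Definition inner_factor j v := (v j y - v j o - h) / (v j y - v j o).
Definition cross_factor j v :=
  (v j o - v j.+1 y - h) * (v j y - v j.+1 o).
(** What the products before and after the passage of o past y have in common
    at the levels c, ..., d that the two labels share. *)
Definition ladder c d v :=
  (\prod_(c <= j < d) (inner_factor j v * cross_factor j v))
  * inner_factor d v.
Definition rung j v := v j y - v j o + h.

Definition swap_invariant c d G := forall (Q : pred nat) v,
  {subset Q <= [pred j | c <= j <= d]%N} -> separated v -> G (swap Q v) = G v.

(** The symmetrization in (s, u) of the factors that join two adjacent levels is
    symmetric in the variables (p, q) of the upper level; [exchange_down] is the
    same with the roles of the two levels interchanged. *)
Lemma exchange_up (s u p q : K) : u - s != 0 -> s - u != 0 ->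
  (u - s - h) / (u - s) * ((s - q - h) * (u - p))
    + (s - u - h) / (s - u) * ((u - q - h) * (s - p))
  = (u - s - h) / (u - s) * ((s - p - h) * (u - q))
    + (s - u - h) / (s - u) * ((u - p - h) * (s - q)).
Proof. by move=> us su; field; rewrite us su. Qed.

Lemma exchange_down (s u p q : K) : q - p != 0 -> p - q != 0 ->
  ((s - q - h) * (u - p)) * ((q - p - h) / (q - p))
    + ((s - p - h) * (u - q)) * ((p - q - h) / (p - q))
  = ((u - q - h) * (s - p)) * ((q - p - h) / (q - p))
    + ((u - p - h) * (s - q)) * ((p - q - h) / (p - q)).
Proof. by move=> us su; field; rewrite us su. Qed.

Lemma inner_rung_antisym j v : separated v -> shared j ->
  inner_factor j (swap (pred1 j) v) * rung j (swap (pred1 j) v)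
  = - (inner_factor j v * rung j v).
Proof.
move=> sep_v sh_j; rewrite /inner_factor /rung !swap_o !swap_y /= eqxx.
have neq := sep_v _ sh_j; field.
by rewrite !subr_eq0 neq eq_sym neq.
Qed.

Lemma eq_ladder c d v v' : (c <= d)%N ->
  (forall j, (c <= j <= d)%N -> v j = v' j) -> ladder c d v = ladder c d v'.
Proof.
move=> le_cd eq_v; congr (_ * _); last by rewrite /inner_factor !eq_v ?le_cd ?leqnn.
apply: eq_big_nat => j /andP[le_cj lt_jd].
by rewrite /inner_factor /cross_factor !eq_v ?le_cj ?(ltnW lt_jd) ?lt_jd ?(leqW le_cj).
Qed.

Lemma sub_pred1_shared c d m : (c <= m <= d)%N ->
  (forall j, (c <= j <= d)%N -> shared j) -> {subset pred1 m <= shared}.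
Proof. by move=> m_in sh j; rewrite inE => /eqP->; apply: sh. Qed.

Lemma swap1_neq m v j : j != m -> swap (pred1 m) v j = v j.
Proof. by move=> neq_jm; rewrite /swap /= (negbTE neq_jm). Qed.

(** Symmetrizing the bottom level c turns its factors into a function that is
    swap invariant at the levels above, which joins G. *)
Lemma symL_ladder_top c m G :
    (forall j, (c <= j <= c + m)%N -> shared j) -> swap_invariant c (c + m) G ->
  symL (fun v => G v * (ladder c (c + m) v * rung (c + m) v)) = 0.
Proof.
elim: m c G => [|m IHm] c G; rewrite ?addn0 => sh Ginv.
  apply: (@symL_antisym (pred1 c)) => [|v sep_v].
    by apply: (sub_pred1_shared _ sh); rewrite leqnn.
  rewrite Ginv //; last by move=> j; rewrite !inE => /eqP->; rewrite leqnn.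
  rewrite /ladder !big_geq // !mul1r inner_rung_antisym ?mulrN //.
  by apply: sh; rewrite leqnn.
have sub_c : {subset pred1 c <= shared}.
  by apply: (sub_pred1_shared _ sh); rewrite leqnn leq_addr.
apply: (mulfI two_neq0); rewrite (symL_average _ sub_c) mulr0.
pose f v := inner_factor c v * cross_factor c v.
pose G' v := G v * (f v + f (swap (pred1 c) v)).
rewrite -addSnnS in sh Ginv *.
rewrite -[RHS](IHm c.+1 G'); first last.
- move=> Q v Qsub sep_v; rewrite /G' Ginv //; last first.
    by move=> j /Qsub; rewrite !inE => /andP[/ltnW-> ->].
  congr (_ * _); rewrite /f /inner_factor /cross_factor.
  have Qc : Q c = false.
    by apply/negP => /Qsub; rewrite !inE ltnn.
  rewrite !(swap_o, swap_y) /= eqxx Qc gtn_eqF //; case: (Q c.+1) => //.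
  have neq : v c o != v c y by apply/sep_v/sh; rewrite leqnn leqW ?leq_addr.
  by apply: exchange_up; rewrite subr_eq0 // eq_sym.
- by move=> j /andP[lt_cj le_jm]; apply: sh; rewrite ltnW.
apply: symL_ext => v sep_v.
rewrite Ginv //; last first.
  by move=> j; rewrite !inE => /eqP->; rewrite leqnn leqW ?leq_addr.
have lt_c : (c < c.+1 + m)%N by rewrite ltnS leq_addr.
have eq_lad v' : ladder c (c.+1 + m) v' = f v' * ladder c.+1 (c.+1 + m) v'.
  by rewrite /ladder big_ltn // mulrA.
rewrite !eq_lad /rung.
rewrite (@eq_ladder c.+1 _ (swap (pred1 c) v) v) ?leq_addr //; last first.
  by move=> j /andP[lt_cj _]; rewrite swap1_neq // gtn_eqF.
by rewrite swap1_neq ?gtn_eqF // /G'; ring.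
Qed.

(** The mirror image of [symL_ladder_top]: here the top level is removed. *)
Lemma symL_ladder_bottom c m G :
    (forall j, (c <= j <= c + m)%N -> shared j) -> swap_invariant c (c + m) G ->
  symL (fun v => G v * (ladder c (c + m) v * rung c v)) = 0.
Proof.
elim: m c G => [|m IHm] c G; first by move: (@symL_ladder_top c 0 G); rewrite addn0.
rewrite addnS => sh Ginv; set d := (c + m)%N in sh Ginv *.
have sub_d : {subset pred1 d.+1 <= shared}.
  by apply: (sub_pred1_shared _ sh); rewrite leqnn leqW ?leq_addr.
apply: (mulfI two_neq0); rewrite (symL_average _ sub_d) mulr0.
pose f v := cross_factor d v * inner_factor d.+1 v.
pose G' v := G v * (f v + f (swap (pred1 d.+1) v)).
rewrite -[RHS](IHm c G'); first last.
- move=> Q v Qsub sep_v; rewrite /G' Ginv //; last first.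
    by move=> j /Qsub; rewrite !inE => /andP[-> /leqW->].
  congr (_ * _); rewrite /f /inner_factor /cross_factor.
  have Qd : Q d.+1 = false.
    by apply/negP => /Qsub; rewrite !inE ltnn andbF.
  rewrite !(swap_o, swap_y) /= eqxx Qd ltn_eqF //; case: (Q d) => //.
  have neq : v d.+1 o != v d.+1 y by apply/sep_v/sh; rewrite leqnn leqW ?leq_addr.
  by apply/esym/exchange_down; rewrite subr_eq0 // eq_sym.
- by move=> j /andP[le_cj le_jm]; apply: sh; rewrite le_cj leqW.
apply: symL_ext => v sep_v.
rewrite Ginv //; last first.
  by move=> j; rewrite !inE => /eqP->; rewrite leqnn leqW ?leq_addr.
have eq_lad v' : ladder c d.+1 v' = ladder c d v' * f v'.
  by rewrite /ladder big_nat_recr ?leq_addr //= /f !mulrA.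
rewrite !eq_lad /rung.
rewrite (@eq_ladder c d (swap (pred1 d.+1) v) v) ?leq_addr //; last first.
  by move=> j /andP[_ le_jd]; rewrite swap1_neq // ltn_eqF.
by rewrite !swap1_neq ?ltn_eqF ?ltnS ?leq_addr // /G'; ring.
Qed.

(** The brackets left by the comparison of the products before and after the
    passage.  There w is the variable of y above the ladder, and r is the
    variable below it: that of y if the chain of y starts lower
    ([symL_ladder_y_longer]), that of o otherwise ([symL_ladder_o_longer]). *)
Section Ladder.
Variables (c m : nat) (C r w : (nat -> nat -> K) -> K).
Notation d := (c + m)%N.
Hypothesis shared_cd : forall j, (c <= j <= d)%N -> shared j.
Hypotheses (C_inv : swap_invariant c d C) (r_inv : swap_invariant c d r)
           (w_inv : swap_invariant c d w).

(** Swapping the labels at the bottom or at the top level leaves both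
    coefficients below unchanged, so that they can be absorbed in C. *)
Lemma symL_ladder_rungs (e : K) :
  symL (fun v => C v * (ladder c d v *
    ((r v - (v c o + v c y + h) / 2%:R) * rung d v
     + e * (w v - (v d o + v d y - h) / 2%:R) * rung c v))) = 0.
Proof.
pose al v := C v * (r v - (v c o + v c y + h) / 2%:R).
pose be v := C v * e * (w v - (v d o + v d y - h) / 2%:R).
transitivity (symL (fun v => al v * (ladder c d v * rung d v))
              + symL (fun v => be v * (ladder c d v * rung c v))).
  by rewrite -symL_add; apply: symL_ext => v _; rewrite /al /be; ring.
rewrite symL_ladder_top ?symL_ladder_bottom ?addr0 // => Q v Qsub sep_v.
  rewrite /be C_inv // w_inv // !(swap_o, swap_y).
  by case: (Q d); rewrite // [v d y + _]addrC.
rewrite /al C_inv // r_inv // !(swap_o, swap_y).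
by case: (Q c); rewrite // [v c y + _]addrC.
Qed.

Lemma symL_ladder_y_longer :
  symL (fun v => C v * (ladder c d v *
    ((r v - v c y - h) * (v d y - w v)
     - (r v - v c o) * (v d o - w v - h)))) = 0.
Proof.
rewrite -[RHS](symL_ladder_rungs 1); apply: symL_ext => v _; rewrite /rung.
by field.
Qed.

Lemma symL_ladder_o_longer :
  symL (fun v => C v * (ladder c d v *
    ((r v - v c o) * (v d y - w v)
     - (r v - v c y - h) * (v d o - w v - h)))) = 0.
Proof.
rewrite -[RHS](symL_ladder_rungs (-1)); apply: symL_ext => v _; rewrite /rung.
by field.
Qed.

End Ladder.

(** Positions are doubled, so that o can sit in the gap before y, at y itself or
    in the gap after y: at c = 2y - 1, 2y or 2y + 1. *)
Definition position (c q : nat) : nat := if q == o then c else q.*2.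

Definition in_pair q := (q == o) || (q == y).

(** The factors of the weight that involve at most one of the labels o and y;
    for these it makes no difference whether o is next to y or at y. *)
Definition common : (nat -> nat -> K) -> K :=
  label_product N L
    (fun p q z => if in_pair p && in_pair q then 1
                  else cross_weight h (position y.*2 p) (position y.*2 q) z)
    (fun p q z => if in_pair p && in_pair q then 1
                  else inner_weight h (position y.*2 p) (position y.*2 q) z).

Definition pair_factor (c j : nat) v : K :=
  (if (o \in L j) && (y \in L j.+1)
   then cross_weight h c y.*2 (v j o - v j.+1 y) else 1)
  * (if (y \in L j) && (o \in L j.+1)
     then cross_weight h y.*2 c (v j y - v j.+1 o) else 1)
  * (if (o \in L j) && (y \in L j)
     then inner_weight h c y.*2 (v j y - v j o)
          * inner_weight h y.*2 c (v j o - v j y) else 1).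

Lemma prod_pair (l : seq nat) (F : nat -> K) : uniq l ->
    (forall p, ~~ in_pair p -> F p = 1) ->
  \prod_(p <- l) F p
  = (if o \in l then F o else 1) * (if y \in l then F y else 1).
Proof.
move=> uniq_l F1.
elim: l uniq_l => [|p l IHl] /=; first by rewrite big_nil mulr1.
move=> /andP[lp /IHl{}IHl]; rewrite big_cons IHl !inE.
case: (boolP (in_pair p)) => [|np]; last first.
  rewrite F1 // mul1r; move: np; rewrite negb_or ![p == _]eq_sym.
  by case/andP => /negbTE-> /negbTE->.
case/orP => /eqP eq_p; rewrite eq_p in lp *.
  by rewrite (negbTE lp) eqxx mul1r [y == o]eq_sym (negbTE neq_oy).
by rewrite (negbTE lp) eqxx (negbTE neq_oy) mulr1 mulrC.
Qed.

Lemma prod_pair2 (l l' : seq nat) (F : nat -> nat -> K) : uniq l -> uniq l' ->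
  \prod_(p <- l) \prod_(q <- l') (if in_pair p && in_pair q then F p q else 1)
  = (if (o \in l) && (o \in l') then F o o else 1)
    * (if (o \in l) && (y \in l') then F o y else 1)
    * (if (y \in l) && (o \in l') then F y o else 1)
    * (if (y \in l) && (y \in l') then F y y else 1).
Proof.
move=> uniq_l uniq_l'.
have op : in_pair o by rewrite /in_pair eqxx.
have yp : in_pair y by rewrite /in_pair eqxx orbT.
rewrite prod_pair // => [|p /negbTE np]; last first.
  by apply: big1 => q _; rewrite np.
have row p : in_pair p -> \prod_(q <- l') (if in_pair p && in_pair q then F p q else 1)
   = (if o \in l' then F p o else 1) * (if y \in l' then F p y else 1).
  move=> pp; rewrite prod_pair ?pp //= => [|q /negbTE nq]; last by rewrite nq.
  by rewrite op yp.
rewrite !row //; case: (o \in l); case: (y \in l) => /=;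
  rewrite ?mulr1 ?mul1r ?mulrA //.
Qed.

Hypothesis L_uniq_top : uniq (L N).

Lemma uniq_level j : (0 < j <= N)%N -> uniq (L j).
Proof.
rewrite [(j <= N)%N]leq_eqVlt andb_orr => /orP[/andP[_ /eqP->] //|]; exact: L_uniq.
Qed.

(** In none of these three places does o compare differently from y with a
    third label. *)
Lemma weightE c v : (y.*2 <= c.+1 <= y.*2.+2)%N ->
  weight h N L (position c) v = common v * \prod_(1 <= j < N) pair_factor c j v.
Proof.
move=> c_near; rewrite -big_split /=; apply: eq_big_nat => j /andP[j_gt0 lt_jN].
have uniq_j : uniq (L j) by apply: uniq_level; rewrite j_gt0 ltnW.
have uniq_j1 : uniq (L j.+1) by apply: uniq_level.
have out p q : ~~ (in_pair p && in_pair q) ->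
    ((position c p < position c q) = (position y.*2 p < position y.*2 q))%N.
  rewrite /in_pair /position; case: (eqVneq p o) => [->|po];
    case: (eqVneq q o) => [->|qo] //=; rewrite ?orbT //=; lia.
have pos_o : position c o = c by rewrite /position eqxx.
have pos_y : position c y = y.*2 by rewrite /position eq_sym (negbTE neq_oy).
have split_cross p q z : cross_weight h (position c p) (position c q) z
  = (if in_pair p && in_pair q then 1
     else cross_weight h (position y.*2 p) (position y.*2 q) z)
  * (if in_pair p && in_pair q then cross_weight h (position c p) (position c q) z
     else 1).
  case: ifP => [_|/negbT npq]; rewrite ?mul1r ?mulr1 // /cross_weight !out //.
  by rewrite andbC.
have split_inner p q z : inner_weight h (position c p) (position c q) z
  = (if in_pair p && in_pair q then 1
     else inner_weight h (position y.*2 p) (position y.*2 q) z)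
  * (if in_pair p && in_pair q then inner_weight h (position c p) (position c q) z
     else 1).
  by case: ifP => [_|/negbT npq]; rewrite ?mul1r ?mulr1 // /inner_weight !out.
under [X in X * _]eq_bigr do under eq_bigr do rewrite split_cross.
under [X in _ * X]eq_bigr do under eq_bigr do rewrite split_inner.
under [X in X * _]eq_bigr do rewrite big_split.
under [X in _ * X]eq_bigr do rewrite big_split.
rewrite !big_split /= !prod_pair2 // mulrACA; congr (_ * _).
rewrite pos_o pos_y /pair_factor /cross_weight /inner_weight !ltnn !if_same.
rewrite !mul1r !mulr1 [(y \in L j) && (o \in L j)]andbC -!mulrA.
by congr (_ * (_ * _)); case: ifP; rewrite ?mulr1.
Qed.

(** As o and y are given the same position, the swap only reorders factors. *)
Lemma common_swap (Q : pred nat) v : {subset Q <= shared} ->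
  common (swap Q v) = common v.
Proof.
move=> Qsh; pose s j := if Q j then swap_label else id.
have swE j q : swap Q v j q = v j (s j q) by rewrite /swap /s; case: (Q j).
have perm_s j : perm_eq (map (s j) (L j)) (L j).
  rewrite /s; case: (boolP (Q j)) => [/Qsh/and3P[j_in oL yL]|_].
    by apply: perm_swap_label => //; apply: L_uniq.
  by rewrite map_id.
have pair_s j q : in_pair (s j q) = in_pair q.
  rewrite /s; case: (Q j) => //; rewrite /in_pair /swap_label.
  case: (eqVneq q o) => [_|neq_qo]; first by rewrite eqxx orbT.
  by case: (eqVneq q y) => [_|neq_qy]; rewrite ?eqxx ?(negbTE neq_qo) ?(negbTE neq_qy).
have pos_s j q : position y.*2 (s j q) = position y.*2 q.
  rewrite /s; case: (Q j) => //; rewrite /position /swap_label.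
  case: (eqVneq q o) => [_|neq_qo] /=; first by rewrite if_same.
  by case: (eqVneq q y) => [->|neq_qy]; rewrite ?eqxx ?(negbTE neq_qo).
apply: eq_bigr => j _; congr (_ * _).
  rewrite -[in RHS](perm_big _ (perm_s j)) big_map; apply: eq_bigr => p _.
  rewrite -[in RHS](perm_big _ (perm_s j.+1)) big_map; apply: eq_bigr => q _.
  by rewrite !swE !pair_s !pos_s.
rewrite -[in RHS](perm_big _ (perm_s j)) big_map; apply: eq_bigr => p _.
rewrite -[in RHS](perm_big _ (perm_s j)) big_map; apply: eq_bigr => q _.
by rewrite !swE !pair_s !pos_s.
Qed.

Section Crossing.
Variables a b k : nat.
Hypotheses (a_gt0 : (0 < a)%N) (lt_ab : (a < b)%N) (le_bN : (b <= N)%N).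
Hypotheses (k_gt0 : (0 < k)%N) (y_gt0 : (0 < y)%N).
Hypothesis mem_o : forall j, (0 < j <= N)%N -> (o \in L j) = (a <= j < b)%N.
Hypothesis mem_y : forall j, (0 < j <= N)%N -> (y \in L j) = (k <= j)%N.

Lemma near_before : (y.*2 <= y.*2.-1.+1 <= y.*2.+2)%N. Proof. by lia. Qed.
Lemma near_at : (y.*2 <= y.*2.+1 <= y.*2.+2)%N. Proof. by lia. Qed.
Lemma near_after : (y.*2 <= y.*2.+2 <= y.*2.+2)%N. Proof. by lia. Qed.

Lemma pair_factorE c j v : (0 < j < N)%N ->
  pair_factor c j v =
  (if (a <= j < b)%N && (k <= j.+1)%N
   then cross_weight h c y.*2 (v j o - v j.+1 y) else 1)
  * (if (k <= j)%N && (a <= j.+1 < b)%N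
     then cross_weight h y.*2 c (v j y - v j.+1 o) else 1)
  * (if (a <= j < b)%N && (k <= j)%N
     then inner_weight h c y.*2 (v j y - v j o)
          * inner_weight h y.*2 c (v j o - v j y) else 1).
Proof.
move=> /andP[j_gt0 lt_jN].
have j_in : (0 < j <= N)%N by rewrite j_gt0 ltnW.
have j1_in : (0 < j.+1 <= N)%N by [].
by rewrite /pair_factor (mem_o j_in) (mem_o j1_in) (mem_y j_in) (mem_y j1_in).
Qed.

Lemma weight_cross_above v : (b < k)%N ->
  weight h N L (position y.*2.+1) v = weight h N L (position y.*2.-1) v.
Proof.
move=> lt_bk; rewrite !weightE ?near_before ?near_after //; congr (_ * _).
apply: eq_big_nat => j j_in; rewrite !pair_factorE //.
by do 3![case: ifP; first by lia].
Qed.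

Lemma prod_levels (f : nat -> K) c d : (0 < c)%N -> (c <= d < N)%N ->
    (forall j, (0 < j)%N -> (j.+1 < c)%N -> f j = 1) ->
    (forall j, (d < j < N)%N -> f j = 1) ->
  \prod_(1 <= j < N) f j
  = (if (1 < c)%N then f c.-1 else 1) * \prod_(c <= j < d) f j * f d.
Proof.
move=> c_gt0 /andP[le_cd lt_dN] f_low f_high.
rewrite (@big_cat_nat _ _ _ d.+1) ?ltnS ?(leq_trans c_gt0) //=.
rewrite [X in _ * X]big1_seq ?mulr1 => [|j]; last first.
  by rewrite mem_index_iota => j_in; apply: f_high.
rewrite big_nat_recr ?(leq_trans c_gt0) //=; congr (_ * _).
rewrite (@big_cat_nat _ _ _ c) //=; congr (_ * _).
case: c c_gt0 f_low {le_cd} => // -[|c] _ f_low; first by rewrite big_geq.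
rewrite big_nat_recr //= big1_seq ?mul1r // => j.
by rewrite mem_index_iota /= => /andP[j_gt0 lt_jc]; apply: f_low.
Qed.

(** The only comparison between o and y is that of level b - 1 with level b,
    whose factors before and after the passage differ by h. *)
Lemma weight_cross_at v : k = b ->
  weight h N L (position y.*2.+1) v - weight h N L (position y.*2.-1) v
  = h * weight h N L (position y.*2) v.
Proof.
move=> eq_kb; rewrite !weightE ?near_before ?near_after ?near_at //.
have b1 : (0 < b.-1 < N)%N by lia.
have val c : \prod_(1 <= j < N) pair_factor c j v
  = cross_weight h c y.*2 (v b.-1 o - v b y).
  rewrite (@prod_levels _ b.-1 b.-1) ?leqnn; try lia; last first.
  - move=> j j_in; rewrite pair_factorE ?eq_kb; try lia.
    by do 3![case: ifP; first by lia]; rewrite ?mulr1.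
  - move=> j j_gt0 j_in; rewrite pair_factorE ?eq_kb; try lia.
    by do 3![case: ifP; first by lia]; rewrite ?mulr1.
  rewrite big_geq // mulr1.
  have -> : (if (1 < b.-1)%N then pair_factor c b.-1.-1 v else 1) = 1.
    case: ifP => // lt_1b; rewrite pair_factorE ?eq_kb; try lia.
    by do 3![case: ifP; first by lia]; rewrite ?mulr1.
  rewrite mul1r pair_factorE // eq_kb.
  have -> : b.-1.+1 = b by lia.
  case: ifP => [_|]; last by lia.
  by do 2![case: ifP; first by lia]; rewrite ?mulr1.
rewrite !val -mulrBr mulrCA; congr (_ * _).
rewrite /cross_weight ltnn.
case: ifP => [_|]; last by lia.
case: ifP => [|_]; first by lia.
case: ifP => [_|]; last by lia.
by ring.
Qed.

(** Here the symmetrization is needed: the products before and after the passage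
    are different functions. *)
Lemma symL_weight_cross_below : (k < b)%N ->
  symL (weight h N L (position y.*2.+1)) = symL (weight h N L (position y.*2.-1)).
Proof.
move=> lt_kb; apply/eqP; rewrite -subr_eq0; apply/eqP.
pose c := maxn a k; pose d := b.-1.
have d1 : d.+1 = b by rewrite /d; lia.
have le_cd : (c <= d)%N by rewrite /c /d; lia.
have c_gt0 : (0 < c)%N by rewrite /c; lia.
have lt_dN : (d < N)%N by rewrite /d; lia.
pose m := (d - c)%N; have eq_d : (c + m = d)%N by rewrite /m subnKC.
have sh j : (c <= j <= d)%N -> shared j.
  move=> j_in; have j_in' : (0 < j <= N)%N by rewrite /c /d in j_in; lia.
  by rewrite /shared (mem_o j_in') (mem_y j_in'); rewrite /c /d in j_in; lia.
(* All the shared levels from c to d are swapped at once in the product after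
   the passage, which turns its inner part into that of the product before. *)
pose Q : pred nat := [pred j | c <= j <= d]%N.
have Qsh : {subset Q <= shared} by move=> j; apply: sh.
have C_inv : swap_invariant c d common.
  by move=> Q' v Q'sub _; apply: common_swap => j /Q'sub; apply: sh.
have out_inv j q : ~~ (c <= j <= d)%N -> swap_invariant c d (fun v => v j q).
  move=> j_out Q' v Q'sub _; rewrite /swap.
  by case: ifP => // /Q'sub; rewrite inE (negbTE j_out).
have QE j : Q j = (c <= j <= d)%N by [].
pose before_factor := pair_factor y.*2.-1; pose after_factor := pair_factor y.*2.+1.
have dbl1 : (y.*2.-1 < y.*2)%N by lia.
have dbl2 : (y.*2 < y.*2.-1)%N = false by lia.
have dbl3 : (y.*2.+1 < y.*2)%N = false by lia.
have beforeE v : \prod_(1 <= j < N) before_factor j v =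
    (if (1 < c)%N then before_factor c.-1 v else 1)
    * (ladder c d v * (v d o - v d.+1 y - h)).
  rewrite (@prod_levels _ c d) ?le_cd //; first last.
  - move=> j j_in; rewrite /before_factor pair_factorE; last by lia.
    by do 3![case: ifP; first by (rewrite /c /d in j_in *; lia)]; rewrite ?mulr1.
  - move=> j j_gt0 j_in; rewrite /before_factor pair_factorE; last by lia.
    by do 3![case: ifP; first by (rewrite /c /d in j_in *; lia)]; rewrite ?mulr1.
  rewrite -mulrA; congr (_ * _); rewrite /ladder -mulrA; congr (_ * _).
    apply: eq_big_nat => j j_in; rewrite /before_factor pair_factorE; last by lia.
    have -> : (a <= j < b)%N && (k <= j.+1)%N by rewrite /c /d in j_in; lia.
    have -> : (k <= j)%N && (a <= j.+1 < b)%N by rewrite /c /d in j_in; lia.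
    have -> : (a <= j < b)%N && (k <= j)%N by rewrite /c /d in j_in; lia.
    rewrite /cross_weight /inner_weight dbl1 dbl2 mulr1.
    by rewrite /inner_factor /cross_factor mulrC.
  rewrite /before_factor pair_factorE; last by lia.
  have -> : (a <= d < b)%N && (k <= d.+1)%N by rewrite /c /d; lia.
  have -> : (k <= d)%N && (a <= d.+1 < b)%N = false by rewrite /c /d; lia.
  have -> : (a <= d < b)%N && (k <= d)%N by rewrite /c /d; lia.
  by rewrite /cross_weight /inner_weight dbl1 dbl2 !mulr1 mulrC.
have afterE v : \prod_(1 <= j < N) after_factor j (swap Q v) =
    (if (1 < c)%N then after_factor c.-1 (swap Q v) else 1)
    * (ladder c d v * (v d y - v d.+1 y)).
  rewrite (@prod_levels _ c d) ?le_cd //; first last.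
  - move=> j j_in; rewrite /after_factor pair_factorE; last by lia.
    by do 3![case: ifP; first by (rewrite /c /d in j_in *; lia)]; rewrite ?mulr1.
  - move=> j j_gt0 j_in; rewrite /after_factor pair_factorE; last by lia.
    by do 3![case: ifP; first by (rewrite /c /d in j_in *; lia)]; rewrite ?mulr1.
  rewrite -mulrA; congr (_ * _); rewrite /ladder -mulrA; congr (_ * _).
    apply: eq_big_nat => j j_in; rewrite /after_factor pair_factorE; last by lia.
    have -> : (a <= j < b)%N && (k <= j.+1)%N by rewrite /c /d in j_in; lia.
    have -> : (k <= j)%N && (a <= j.+1 < b)%N by rewrite /c /d in j_in; lia.
    have -> : (a <= j < b)%N && (k <= j)%N by rewrite /c /d in j_in; lia.
    rewrite /cross_weight /inner_weight dbl3 ltnSn mul1r.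
    rewrite !(swap_o, swap_y) !QE.
    have -> : (c <= j <= d)%N by lia.
    have -> : (c <= j.+1 <= d)%N by lia.
    by rewrite /inner_factor /cross_factor; ring.
  rewrite /after_factor pair_factorE; last by lia.
  have -> : (a <= d < b)%N && (k <= d.+1)%N by rewrite /c /d; lia.
  have -> : (k <= d)%N && (a <= d.+1 < b)%N = false by rewrite /c /d; lia.
  have -> : (a <= d < b)%N && (k <= d)%N by rewrite /c /d; lia.
  rewrite /cross_weight /inner_weight dbl3 ltnSn mul1r mulr1.
  rewrite !(swap_o, swap_y) !QE le_cd leqnn ltnn andbF.
  by rewrite mulrC.
rewrite -(symL_swap (weight h N L _) Qsh) -symL_sub.
transitivity (symL (fun v => common v * (ladder c d v *
   ((if (1 < c)%N then after_factor c.-1 (swap Q v) else 1) * (v d y - v d.+1 y)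
    - (if (1 < c)%N then before_factor c.-1 v else 1) * (v d o - v d.+1 y - h))))).
  apply: symL_ext => v sep_v /=; rewrite !weightE ?near_before ?near_after //.
  by rewrite -/before_factor -/after_factor beforeE afterE C_inv //; ring.
have out_top : swap_invariant c d (fun v => v d.+1 y) by apply: out_inv; lia.
have Qc1 : Q c.-1 = false by rewrite QE; lia.
have Qc : Q c by rewrite QE; lia.
have [eq_ca|[lt_ak|lt_ka]] : a = k \/ ((a < k)%N \/ (k < a)%N) by lia.
- transitivity (symL (fun v => common v * (ladder c d v * rung d v))); last first.
    by rewrite -eq_d in C_inv sh *; apply: symL_ladder_top.
  apply: symL_ext => v _; congr (_ * (_ * _)).
  have one e w : (1 < c)%N -> pair_factor e c.-1 w = 1.
    move=> c_gt1; rewrite pair_factorE; last by rewrite /c; lia.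
    by do 3![case: ifP; first by (rewrite /c; lia)]; rewrite ?mulr1.
  by rewrite /before_factor /after_factor; case: ifP => [/one e1|_];
     rewrite ?e1 /rung; ring.
- have eq_c : c = k by rewrite /c; lia.
  have c_gt1 : (1 < c)%N by lia.
  transitivity (symL (fun v => common v * (ladder c d v *
    ((v c.-1 o - v c o) * (v d y - v d.+1 y)
     - (v c.-1 o - v c y - h) * (v d o - v d.+1 y - h))))); last first.
    have low := out_inv c.-1 o; rewrite -eq_d in C_inv sh out_top low *.
    by apply: symL_ladder_o_longer => //; apply: low; lia.
  apply: symL_ext => v _; congr (_ * (_ * _)).
  rewrite c_gt1 /before_factor /after_factor !pair_factorE; try lia.
  have -> : c.-1.+1 = c by lia.
  have -> : ((a <= c.-1) && (c <= b))%N && (k <= c)%N by lia.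
  have -> : (k <= c.-1)%N && (a <= c < b)%N = false by lia.
  have -> : ((a <= c.-1) && (c <= b))%N && (k <= c.-1)%N = false by lia.
  rewrite /cross_weight dbl1 dbl2 dbl3 ltnSn !mulr1.
  by rewrite !(swap_o, swap_y) Qc1 Qc.
have eq_c : c = a by rewrite /c; lia.
have c_gt1 : (1 < c)%N by lia.
transitivity (symL (fun v => common v * (ladder c d v *
  ((v c.-1 y - v c y - h) * (v d y - v d.+1 y)
   - (v c.-1 y - v c o) * (v d o - v d.+1 y - h))))); last first.
  have low := out_inv c.-1 y; rewrite -eq_d in C_inv sh out_top low *.
  by apply: symL_ladder_y_longer => //; apply: low; lia.
apply: symL_ext => v _; congr (_ * (_ * _)).
rewrite c_gt1 /before_factor /after_factor !pair_factorE; try lia.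
have -> : c.-1.+1 = c by lia.
have -> : ((a <= c.-1) && (c <= b))%N && (k <= c)%N = false by lia.
have -> : (k <= c.-1)%N && (a <= c < b)%N by lia.
have -> : ((a <= c.-1) && (c <= b))%N && (k <= c.-1)%N = false by lia.
rewrite /cross_weight dbl1 dbl3 ltnSn !mulr1 !mul1r.
by rewrite !(swap_o, swap_y) Qc1 Qc.
Qed.

End Crossing.

End Exchange.

(** * Ordered partitions as maps to the parts *)

Section Blocks.
Variables (N n : nat).
Implicit Types (A : {set 'I_n}) (f : 'I_n -> 'I_N) (lam : {ffun 'I_N -> nat}).

Definition members A : seq nat := [seq val z | z <- enum A].

(** The ordered partition whose part k is the fibre of f over k; all the
    partitions of the theorem come from one map by reassigning values. *)
Definition blocks f : {ffun 'I_N -> {set 'I_n}} := [ffun k => [set z | f z == k]].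

Definition reassign f (x : 'I_n) (k : 'I_N) : 'I_n -> 'I_N :=
  fun z => if z == x then k else f z.

Definition level f (j : nat) : {set 'I_n} := [set z | (f z < j)%N].

Lemma mem_blocks f k z : (z \in blocks f k) = (f z == k).
Proof. by rewrite ffunE inE. Qed.

Lemma members_uniq A : uniq (members A).
Proof. by rewrite map_inj_uniq ?enum_uniq //; apply: val_inj. Qed.

Lemma size_members A : size (members A) = #|A|.
Proof. by rewrite size_map cardE. Qed.

Lemma mem_members A (z : 'I_n) : (val z \in members A) = (z \in A).
Proof. by rewrite mem_map ?mem_enum //; apply: val_inj. Qed.

Lemma members_lt A q : q \in members A -> (q < n)%N.
Proof. by case/mapP => z _ ->; apply: ltn_ord. Qed.

Lemma members_sorted A : sorted ltn (members A).
Proof.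
have: subseq (members A) (iota 0 n).
  rewrite -val_enum_ord map_subseq // enumT.
  by rewrite [enum A]/(enum_mem _) filter_subseq.
by move/(subseq_sorted ltn_trans); apply; apply: iota_ltn_sorted.
Qed.

Lemma nth_members_lt A a b : (a < #|A|)%N -> (b < #|A|)%N ->
  (nth 0%N (members A) a < nth 0%N (members A) b)%N = (a < b)%N.
Proof.
move=> lt_a lt_b.
have := @sorted_ltn_nth _ _ ltn_trans 0%N _ (members_sorted A).
rewrite size_members => lt_nth.
case: (ltngtP a b) => [lt_ab|lt_ba|->]; last exact: ltnn.
  exact: lt_nth.
by apply/negbTE; rewrite -leqNgt ltnW // lt_nth.
Qed.

Lemma members_setT : members [set: 'I_n] = iota 0 n.
Proof. by rewrite /members enum_setT -val_enum_ord enumT. Qed.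

Lemma level_top f : level f N = [set: 'I_n].
Proof. by apply/setP => z; rewrite !inE ltn_ord. Qed.

Lemma level_blocks f j :
  \bigcup_(k < N | (k < j)%N) blocks f k = level f j.
Proof.
apply/setP => z; rewrite inE; apply/bigcupP/idP => [[k lt_kj]|lt_fj].
  by rewrite ffunE inE => /eqP->.
by exists (f z); rewrite // ffunE inE.
Qed.

Lemma ordered_partition_blocks lam (I : {ffun 'I_N -> {set 'I_n}}) :
  ordered_partition lam I ->
  exists f, I = blocks f /\ forall k, lam k = #|blocks f k|.
Proof.
case/and3P => /forallP card_I /forallP disj_I /eqP cover_I.
have ex_part z : exists k, z \in I k.
  have: z \in \bigcup_k I k by rewrite cover_I inE.
  by case/bigcupP => k _ zIk; exists k.
have [f fP] := fin_all_exists ex_part.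
have eq_I : I = blocks f.
  apply/ffunP => k; apply/setP => z; rewrite ffunE inE.
  apply/idP/eqP => [zIk|<- //]; apply/eqP/contraT => neq_fk.
  have /forallP/(_ k)/implyP/(_ neq_fk) := disj_I (f z).
  by move/disjoint_setI0/setP/(_ z); rewrite !inE fP zIk.
by exists f; split=> // k; rewrite -eq_I (eqP (card_I k)).
Qed.

Lemma psum_blocks lam f j : (forall k, lam k = #|blocks f k|) ->
  psum lam j = #|level f j|.
Proof.
move=> lam_f; rewrite /psum -sum1_card.
rewrite (partition_big f (fun k : 'I_N => (k < j)%N)) => [|z]; last by rewrite inE.
apply: eq_bigr => k lt_kj; rewrite lam_f -sum1_card; apply: eq_bigl => z.
by rewrite ffunE !inE; case: eqP => [->|_]; rewrite ?lt_kj ?andbF.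
Qed.

Lemma shift_blocks lam f (al be : 'I_N) x : al != be -> f x = al ->
    (forall k, lam k = #|blocks f k|) ->
  forall k, shift lam al be k = #|blocks (reassign f x be) k|.
Proof.
move=> neq_ab fx lam_f k; rewrite !ffunE.
case: (eqVneq k al) => [->|neq_ka].
  rewrite lam_f (cardsD1 x) ffunE inE fx eqxx /=; apply: eq_card => z.
  by rewrite !inE /reassign; case: (eqVneq z x) => //= _; rewrite eq_sym (negbTE neq_ab).
case: (eqVneq k be) => [->|neq_kb].
  rewrite lam_f [in RHS](cardsD1 x) inE /reassign eqxx eqxx add1n; congr _.+1.
  apply: eq_card => z; rewrite ffunE !inE; case: (eqVneq z x) => //= ->.
  by rewrite fx (negbTE neq_ab).
rewrite lam_f; apply: eq_card => z; rewrite ffunE !inE /reassign.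
by case: (eqVneq z x) => // ->; rewrite fx ![_ == k]eq_sym (negbTE neq_ka) (negbTE neq_kb).
Qed.

Lemma point_val (x : 'I_n) : point n (val x) = [set x].
Proof. by apply/setP => z; rewrite !inE. Qed.

Lemma move_blocks f (al be : 'I_N) a x : al != be -> f x = al ->
    ell (blocks f) al a = val x ->
  move (blocks f) al be a = blocks (reassign f x be).
Proof.
move=> neq_ab fx ell_a; apply/ffunP => k; rewrite [LHS]ffunE [RHS]ffunE ell_a point_val.
apply/setP => z; case: (eqVneq k al) => [->|neq_ka].
  rewrite !ffunE !inE /reassign.
  by case: (eqVneq z x) => //= _; rewrite eq_sym (negbTE neq_ab).
case: (eqVneq k be) => [->|neq_kb]; rewrite ffunE !inE /reassign.
  by case: (eqVneq z x) => [_|]; rewrite ?eqxx ?orbT ?orbF.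
by case: (eqVneq z x) => // ->; rewrite fx ![_ == k]eq_sym (negbTE neq_ka) (negbTE neq_kb).
Qed.

Lemma exchange_blocks f (al be : 'I_N) a b x y : al != be -> f x = al ->
    f y = be -> ell (blocks f) al a = val x -> ell (blocks f) be b = val y ->
  exchange (blocks f) al be a b = blocks (reassign (reassign f x be) y al).
Proof.
move=> neq_ab fx fy ell_a ell_b.
have neq_xy : x != y by apply: contra neq_ab => /eqP eq_xy; rewrite -fx eq_xy fy.
apply/ffunP => k; rewrite [LHS]ffunE [RHS]ffunE ell_a ell_b !point_val.
apply/setP => z; case: (eqVneq k al) => [->|neq_ka].
  rewrite !ffunE !inE /reassign.
  case: (eqVneq z y) => [->|_]; first by rewrite eqxx orbT.
  by case: (eqVneq z x) => [_|_]; rewrite /= ?orbF // eq_sym (negbTE neq_ab).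
case: (eqVneq k be) => [->|neq_kb]; rewrite ffunE !inE /reassign.
  case: (eqVneq z y) => [->|_].
    by rewrite [y == x]eq_sym (negbTE neq_xy) (negbTE neq_ab).
  by case: (eqVneq z x) => [_|_]; rewrite /= ?eqxx ?orbT ?orbF.
case: (eqVneq z y) => [->|_].
  by rewrite fy ![_ == k]eq_sym (negbTE neq_ka) (negbTE neq_kb).
by case: (eqVneq z x) => [->|//]; rewrite fx ![_ == k]eq_sym (negbTE neq_ka) (negbTE neq_kb).
Qed.

End Blocks.

(** * Weight functions as products over labels *)

Section LabelledWeight.
Variables (K : fieldType) (h : K) (N n : nat).
Implicit Types (f : 'I_n -> 'I_N) (lam : {ffun 'I_N -> nat}) (t : assignment K).

Definition level_seq f (j : nat) : seq nat := members (level f j).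

Lemma prod_index (l : seq nat) (F : nat -> K) : uniq l ->
  \prod_(p <- l) F (index p l) = \prod_(a < size l) F a.
Proof.
move=> uniq_l; rewrite (big_nth 0%N) big_mkord; apply: eq_bigr => a _.
by rewrite index_uniq.
Qed.

(** U_I in terms of elements: the subscripts of the variables disappear. *)
Lemma U_weight lam f t : (forall k, lam k = #|blocks f k|) ->
  U h lam (blocks f) t
  = weight h N (level_seq f) id (labelled (level_seq f) t).
Proof.
move=> lam_f; apply: eq_big_nat => j _.
have ielE i a : iel (blocks f) i a = nth 0%N (level_seq f i) a.
  by rewrite /iel level_blocks.
have sizeE i : psum lam i = size (level_seq f i).
  by rewrite (psum_blocks _ lam_f) size_members.
rewrite [X in _ = X * _](big_nth 0%N) [X in _ = _ * X](big_nth 0%N).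
rewrite !big_mkord -sizeE -big_split /=; apply: eq_bigr => a _.
have lt_a := ltn_ord a.
rewrite [X in _ = X * _](big_nth 0%N) [X in _ = _ * X](big_nth 0%N).
rewrite !big_mkord -!sizeE; congr (_ * _).
  rewrite [X in X * _]big_mkcond [X in _ * X]big_mkcond -big_split /=.
  apply: eq_bigr => c _; rewrite !ielE /labelled !index_uniq ?members_uniq -?sizeE //.
  rewrite /cross_weight; case: ifP => [lt_ca|_]; last by rewrite mul1r.
  by rewrite ltnNge ltnW // mulr1.
rewrite big_mkcond; apply: eq_bigr => b _.
rewrite /labelled !index_uniq ?members_uniq -?sizeE // /inner_weight.
by rewrite nth_members_lt // -size_members -sizeE.
Qed.

Lemma label_product_relabel (L L' : nat -> seq nat) (r : nat -> nat) cw iw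
    (v : nat -> nat -> K) :
    (forall j, (0 < j <= N)%N -> perm_eq (map r (L j)) (L' j)) ->
  label_product N L' cw iw v
  = label_product N L (fun p q => cw (r p) (r q)) (fun p q => iw (r p) (r q))
      (fun j q => v j (r q)).
Proof.
move=> perm_r; apply: eq_big_nat => j /andP[j_gt0 lt_jN].
have perm_j : perm_eq (map r (L j)) (L' j) by apply: perm_r; rewrite j_gt0 ltnW.
have perm_j1 : perm_eq (map r (L j.+1)) (L' j.+1) by rewrite perm_r.
congr (_ * _); rewrite -(perm_big _ perm_j) big_map; apply: eq_bigr => p _.
  by rewrite -(perm_big _ perm_j1) big_map.
by rewrite -(perm_big _ perm_j) big_map.
Qed.

Lemma eq_label_product (L : nat -> seq nat) cw iw cw' iw' (v v' : nat -> nat -> K) :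
    (forall j p q z, (0 < j < N)%N -> p \in L j -> q \in L j.+1 ->
       cw p q z = cw' p q z) ->
    (forall j p q z, (0 < j < N)%N -> p \in L j -> q \in L j ->
       iw p q z = iw' p q z) ->
    (forall j p, (0 < j <= N)%N -> p \in L j -> v j p = v' j p) ->
  label_product N L cw iw v = label_product N L cw' iw' v'.
Proof.
move=> eq_c eq_i eq_v; apply: eq_big_nat => j j_in.
have j_in' : (0 < j <= N)%N by case/andP: j_in => -> /ltnW.
congr (_ * _); apply: eq_big_seq => p Lp; apply: eq_big_seq => q Lq.
  have j_in1 : (0 < j.+1 <= N)%N by case/andP: j_in.
  by rewrite (eq_c j) // (eq_v j) // (eq_v j.+1).
by rewrite (eq_i j) // !eq_v.
Qed.

Lemma prod_window (F : nat -> K) a b m : (0 < a)%N -> (a <= b)%N -> (b <= m)%N ->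
  \prod_(1 <= j < m) (if (a <= j < b)%N then F j else 1) = \prod_(a <= j < b) F j.
Proof.
move=> a_gt0 le_ab le_bm.
rewrite (@big_cat_nat _ _ _ b) ?(leq_trans a_gt0) //=.
rewrite [X in _ * X]big1_seq ?mulr1 => [|j]; last first.
  by rewrite mem_index_iota /= => /andP[le_bj _]; rewrite ltnNge le_bj andbF.
rewrite (@big_cat_nat _ _ _ a) //=.
rewrite big1_seq ?mul1r => [|j]; last first.
  by rewrite mem_index_iota /= => /andP[_ lt_ja]; rewrite leqNgt lt_ja.
by apply: eq_big_nat => j ->.
Qed.

End LabelledWeight.

(** * The mobile part of a chain of variables *)

Section Mobile.
Variables (K : fieldType) (h : K) (N n : nat) (lam : {ffun 'I_N -> nat}).
Variables (f : 'I_n -> 'I_N) (al be : 'I_N) (x : 'I_n).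
Hypotheses (lt_ab : (al < be)%N) (fx : f x = be).
Hypothesis lam_f : forall k, lam k = #|blocks (reassign f x al) k|.
Implicit Types (t : assignment K) (v : nat -> nat -> K) (w y : 'I_n).

(** The map f is the partition in which x, and any other w with f w = be, lies
    in the later part be.  The extra label n stands for the lower piece of a
    chain, at the levels al + 1, ..., be; it is listed last, which is where the
    operator dcheck expects the variables of the removed levels. *)
Definition mobile_seq (j : nat) : seq nat :=
  level_seq f j ++ nseq (al < j <= be)%N n.

Lemma level_reassign w j : f w = be ->
  level (reassign f w al) j = if (al < j <= be)%N then w |: level f j else level f j.
Proof.
move=> fw; apply/setP => z; case: ifP => j_in; rewrite !inE /reassign.
  by case: eqVneq => [_|//]; case/andP: j_in => ->.
by case: eqVneq => // ->; rewrite fw; lia.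
Qed.

Lemma level_notin w j : f w = be -> (j <= be)%N -> w \notin level f j.
Proof. by move=> fw le_jb; rewrite inE fw -leqNgt. Qed.

Lemma size_level_seq j :
  size (level_seq f j) = (psum lam j - (al < j <= be))%N.
Proof.
rewrite size_members (psum_blocks _ lam_f) level_reassign //.
by case: ifP => [/andP[_ le_jb]|]; rewrite ?subn0 // cardsU1 level_notin // add1n subn1.
Qed.

Lemma psum_gt0 j : (al < j)%N -> (0 < psum lam j)%N.
Proof.
move=> lt_aj; rewrite (psum_blocks _ lam_f) card_gt0; apply/set0Pn; exists x.
by rewrite inE /reassign eqxx.
Qed.

Lemma size_mobile_seq j : size (mobile_seq j) = psum lam j.
Proof.
rewrite size_cat size_nseq size_level_seq subnK //.
by case: (boolP (al < j <= be)%N) => // /andP[/psum_gt0].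
Qed.

Lemma level_seq_notin j : n \notin level_seq f j.
Proof. by apply/negP => /members_lt; rewrite ltnn. Qed.

Lemma mobile_seq_uniq j : uniq (mobile_seq j).
Proof.
rewrite cat_uniq members_uniq; case: (al < j <= be)%N => //=.
by rewrite orbF level_seq_notin.
Qed.

Lemma mem_mobile_n j : (n \in mobile_seq j) = (al.+1 <= j < be.+1)%N.
Proof.
by rewrite mem_cat (negbTE (level_seq_notin j)) mem_nseq eqxx andbT lt0b.
Qed.

Lemma mem_mobile_val y j : ((y : nat) \in mobile_seq j) = (f y < j)%N.
Proof.
rewrite mem_cat -[nat_of_ord y]/(val y) mem_members inE mem_nseq.
rewrite [val y == n]ltn_eqF ?ltn_ord //.
by rewrite andbF orbF.
Qed.

Lemma mobile_seq_top : mobile_seq N = iota 0 n.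
Proof.
have -> : mobile_seq N = level_seq f N.
  by rewrite /mobile_seq [(N <= be)%N]leqNgt (ltn_ord be) andbF cats0.
by rewrite /level_seq level_top members_setT.
Qed.

Definition rename (w q : nat) : nat := if q == n then w else q.

Lemma rename_lt w q : q \in iota 0 n -> rename w q = q.
Proof. by rewrite mem_iota /rename => /andP[_ lt_qn]; rewrite ltn_eqF. Qed.

(** Calling the extra label w glues the lower piece to the chain of w, which
    brings w back to the part al. *)
Lemma perm_rename w j : f w = be ->
  perm_eq (map (rename w) (mobile_seq j)) (level_seq (reassign f w al) j).
Proof.
move=> fw; rewrite map_cat map_nseq.
have -> : map (rename w) (level_seq f j) = level_seq f j.
  rewrite -[RHS]map_id; apply/eq_in_map => q /members_lt lt_qn.
  by rewrite rename_lt // mem_iota.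
rewrite {1}/rename eqxx; apply: uniq_perm; rewrite ?members_uniq //.
  rewrite cat_uniq members_uniq; case: (boolP (al < j <= be)%N) => // /andP[_ le_jb] /=.
  by rewrite orbF mem_members level_notin.
move=> q; rewrite mem_cat mem_nseq.
apply/idP/idP => [/orP[Lq|]|].
- have lt_qn := members_lt Lq; move: Lq.
  rewrite -[q]/(val (Ordinal lt_qn)) !mem_members level_reassign //.
  by case: ifP => // _; rewrite !inE => ->; rewrite orbT.
- case/andP=> + /eqP->; rewrite lt0b => j_in.
  by rewrite mem_members level_reassign // j_in !inE eqxx.
move=> Lq; have lt_qn := members_lt Lq; move: Lq.
rewrite -[q]/(val (Ordinal lt_qn)) !mem_members level_reassign //.
case: ifP => [j_in|_]; last by move->.
by rewrite in_setU1 => /orP[/eqP<-|->] //; rewrite eqxx orbT.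
Qed.

Lemma weight_at w v : f w = be ->
  weight h N (mobile_seq) (position n w.*2) (fun j q => v j (rename w q))
  = weight h N (level_seq (reassign f w al)) id v.
Proof.
move=> fw; rewrite [RHS](label_product_relabel _ _ _ (fun j _ => perm_rename j fw)).
have posE q : position n w.*2 q = (rename w q).*2.
  by rewrite /position /rename; case: ifP.
by apply: eq_label_product => // j p q z _ _ _;
   rewrite /cross_weight /inner_weight !posE !ltn_double.
Qed.

(** Immediately after w, the extra label compares with the other labels as w
    does, except with w itself at level be + 1, and there it contributes the
    factor that the chain of w omits. *)
Lemma weight_start w v : f w = be ->
  weight h N (mobile_seq) (position n w.*2.+1) (fun j q => v j (rename w q))
  = (v be w - v be.+1 w) * weight h N (level_seq (reassign f w al)) id v.
Proof.
move=> fw.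
rewrite [X in _ = _ * X](label_product_relabel _ _ _ (fun j _ => perm_rename j fw)).
pose F (p q : nat) z : K := if (p == n) && (q == val w) then z else 1.
have neq_nw : n != w by rewrite gtn_eqF.
have be_in : (0 < be < N)%N by rewrite ltn_ord (leq_trans _ lt_ab).
have -> : v be w - v be.+1 w
  = \prod_(1 <= j < N) (if (be <= j < be.+1)%N then v j w - v j.+1 w else 1).
  by case/andP: be_in => b_gt0 lt_bN; rewrite prod_window // big_nat1.
rewrite -big_split /=; apply: eq_big_nat => j j_in.
rewrite mulrA; congr (_ * _); last first.
  apply: eq_big_seq => p Lp; apply: eq_big_seq => q Lq; rewrite /inner_weight.
  suff -> : (position n w.*2.+1 p < position n w.*2.+1 q)%N
          = (rename w p < rename w q)%N by [].
  rewrite /position /rename; case: (eqVneq p n) => [eq_p|neq_p];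
    case: (eqVneq q n) => [eq_q|neq_q]; rewrite ?ltnn ?ltn_double //.
  - by lia.
  - rewrite eq_q mem_mobile_n in Lq.
    case: (ltngtP p w) => // [||eq_p]; try lia.
    by rewrite eq_p mem_mobile_val fw in Lp; lia.
have -> : (if (be <= j < be.+1)%N then v j w - v j.+1 w else 1)
  = \prod_(p <- mobile_seq j) \prod_(q <- mobile_seq j.+1)
      (if in_pair n w p && in_pair n w q
       then F p q (v j (rename w p) - v j.+1 (rename w q)) else 1).
  rewrite prod_pair2 ?mobile_seq_uniq // /F !eqxx [val w == n]eq_sym (negbTE neq_nw) /=.
  rewrite !if_same mul1r !mulr1 mem_mobile_n mem_mobile_val fw.
  rewrite /rename eqxx [val w == n]eq_sym (negbTE neq_nw).
  by congr (if _ then _ else _); lia.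
rewrite -big_split; apply: eq_big_seq => p Lp.
rewrite -big_split; apply: eq_big_seq => q Lq /=.
rewrite /cross_weight /position /rename /in_pair /F.
case: (eqVneq p n) => [eq_p|neq_p]; case: (eqVneq q n) => [eq_q|neq_q] /=.
- by rewrite !ltnn eq_q (negbTE neq_nw) mulr1.
- case: (ltngtP q w) => [lt_qw|lt_wq|->] /=.
  + by rewrite mul1r; case: ifP => //; lia.
  + rewrite mul1r; case: ifP; first by lia.
    by case: ifP => //; lia.
  + by rewrite mulr1; case: ifP => //; lia.
- rewrite eq_q mem_mobile_n in Lq.
  have neq_pw : p != w.
    by apply: contraTneq Lp => ->; rewrite mem_mobile_val fw; lia.
  rewrite (negbTE neq_pw) /= mul1r.
  by do ![case: ifP => //]; lia.
by rewrite andbC /= if_same mul1r !ltn_double.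
Qed.


Lemma prod_mobile (F : nat -> K) j :
  \prod_(p <- mobile_seq j) F p
  = \prod_(p <- level_seq f j) F p * (if (al < j < be.+1)%N then F n else 1).
Proof.
rewrite big_cat /=; congr (_ * _).
by case: (al < j <= be)%N; rewrite /= ?big_seq1 ?big_nil.
Qed.

(** The position 2n - 1 lies beyond those of all the elements. *)
Lemma weight_end v :
  weight h N (mobile_seq) (position n n.*2.-1) v
  = weight h N (level_seq f) id v *
    ((\prod_(1 <= j < N) (if (al < j.+1 < be.+1)%N
        then \prod_(p <- level_seq f j) (v j p - v j.+1 n - h) else 1))
     * (\prod_(1 <= j < N) (if (al < j < be.+1)%N
        then \prod_(q <- level_seq f j.+1) (v j n - v j.+1 q) else 1))
     * (\prod_(1 <= j < N) (if (al < j < be.+1)%N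
        then \prod_(p <- level_seq f j) ((v j n - v j p - h) / (v j n - v j p))
        else 1))).
Proof.
rewrite -!big_split /=; apply: eq_big_nat => j j_in.
have pos_n : position n n.*2.-1 n = n.*2.-1 by rewrite /position eqxx.
have pos_lt q : (q < n)%N -> position n n.*2.-1 q = q.*2.
  by move=> lt_qn; rewrite /position ltn_eqF.
have cross_lt p q z : (p < n)%N -> (q < n)%N ->
    cross_weight h (position n n.*2.-1 p) (position n n.*2.-1 q) z = cross_weight h p q z.
  by move=> lt_p lt_q; rewrite !pos_lt // /cross_weight !ltn_double.
have cross_n q z : (q < n)%N ->
    cross_weight h n.*2.-1 (position n n.*2.-1 q) z = z.
  by move=> lt_q; rewrite pos_lt // /cross_weight; case: ifP => //; lia.
have cross_to_n q z : (q < n)%N ->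
    cross_weight h (position n n.*2.-1 q) n.*2.-1 z = z - h.
  move=> lt_q; rewrite pos_lt // /cross_weight.
  by case: ifP => [|_]; [|case: ifP => //]; lia.
rewrite prod_mobile.
under [X in X * _ * _]eq_bigr do rewrite prod_mobile.
rewrite big_split prod_mobile /= pos_n.
rewrite [X in _ * X]prod_mobile.
under [X in _ * (X * _)]eq_bigr do rewrite prod_mobile.
rewrite [X in _ * (X * _)]big_split prod_mobile /= pos_n.
have -> : \prod_(p <- level_seq f j) \prod_(q <- level_seq f j.+1)
     cross_weight h (position n n.*2.-1 p) (position n n.*2.-1 q) (v j p - v j.+1 q)
  = \prod_(p <- level_seq f j) \prod_(q <- level_seq f j.+1)
     cross_weight h p q (v j p - v j.+1 q).
  apply: eq_big_seq => p /members_lt lt_p; apply: eq_big_seq => q /members_lt lt_q.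
  exact: cross_lt.
have -> : \prod_(p <- level_seq f j) \prod_(q <- level_seq f j)
     inner_weight h (position n n.*2.-1 p) (position n n.*2.-1 q) (v j q - v j p)
  = \prod_(p <- level_seq f j) \prod_(q <- level_seq f j)
     inner_weight h p q (v j q - v j p).
  apply: eq_big_seq => p /members_lt lt_p; apply: eq_big_seq => q /members_lt lt_q.
  by rewrite !pos_lt // /inner_weight ltn_double.
have -> : \prod_(q <- level_seq f j)
    inner_weight h n.*2.-1 (position n n.*2.-1 q) (v j q - v j n) = 1.
  rewrite big_seq big1 // => q /members_lt lt_q; rewrite pos_lt // /inner_weight.
  by case: ifP => //; lia.
have -> : \prod_(q <- level_seq f j.+1)
    cross_weight h n.*2.-1 (position n n.*2.-1 q) (v j n - v j.+1 q)
  = \prod_(q <- level_seq f j.+1) (v j n - v j.+1 q).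
  by apply: eq_big_seq => q /members_lt lt_q; apply: cross_n.
have -> : \prod_(p <- level_seq f j) (if (al < j.+1 < be.+1)%N
      then cross_weight h (position n n.*2.-1 p) n.*2.-1 (v j p - v j.+1 n) else 1)
  = if (al < j.+1 < be.+1)%N
    then \prod_(p <- level_seq f j) (v j p - v j.+1 n - h) else 1.
  case: ifP => _; last by rewrite big1.
  by apply: eq_big_seq => q /members_lt lt_q; apply: cross_to_n.
have -> : \prod_(p <- level_seq f j) (if (al < j < be.+1)%N
      then inner_weight h (position n n.*2.-1 p) n.*2.-1 (v j n - v j p) else 1)
  = if (al < j < be.+1)%N
    then \prod_(p <- level_seq f j) ((v j n - v j p - h) / (v j n - v j p)) else 1.
  case: ifP => _; last by rewrite big1.
  apply: eq_big_seq => q /members_lt lt_q; rewrite pos_lt // /inner_weight.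
  by case: ifP => //; lia.
rewrite /cross_weight /inner_weight !ltnn !if_same !mulr1.
have arrange (b c d e g : K) : b * c * d * (e * g * 1) = b * e * (c * d * g).
  by ring.
by rewrite if_same arrange.
Qed.

Lemma labelled_mobile t j q : q \in level_seq f j ->
  labelled mobile_seq t j q = t j (index q (level_seq f j)).
Proof. by move=> Lq; rewrite /labelled index_cat Lq. Qed.

Lemma labelled_mobile_n t j : (al < j < be.+1)%N ->
  labelled mobile_seq t j n = t j (psum lam j).-1.
Proof.
move=> j_in; rewrite /labelled index_cat (negbTE (level_seq_notin j)).
by rewrite size_level_seq -[(j <= be)%N]/(j < be.+1)%N j_in /= eqxx addn0 subn1.
Qed.

Lemma shift_moved k : shift lam al be k = #|blocks f k|.
Proof.
have eq_f : reassign (reassign f x al) x be = f.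
  by apply: funext => z; rewrite /reassign; case: eqVneq => // ->.
rewrite (shift_blocks (x := x) _ _ lam_f) ?eq_f //.
  by rewrite neq_ltn lt_ab.
by rewrite /reassign eqxx.
Qed.

(** The factors of the extra label in [weight_end] are those of B, except that
    B writes the product for level al and that for level be + 1 with the last
    variable split off. *)
Lemma dcheck_integrand t :
  U h (shift lam al be) (blocks f) t * B h lam al.+1 be.+1 t
  = weight h N mobile_seq (position n n.*2.-1) (labelled mobile_seq t).
Proof.
have lt_bN := ltn_ord be.
rewrite weight_end (U_weight _ _ shift_moved); congr (_ * _).
  apply: eq_label_product => // j p _ Lp.
  by rewrite labelled_mobile.
pose last j := t j (psum lam j).-1.
pose X i := \prod_(m < size (level_seq f i.-1)) (t i.-1 m - last i - h).
pose Y j := \prod_(m < size (level_seq f j.+1)) (last j - t j.+1 m).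
pose Z j := \prod_(m < size (level_seq f j)) ((last j - t j m - h) / (last j - t j m)).
have XE : \prod_(1 <= j < N) (if (al < j.+1 < be.+1)%N
        then \prod_(p <- level_seq f j)
               (labelled mobile_seq t j p - labelled mobile_seq t j.+1 n - h) else 1)
  = \prod_(al.+1 <= i < be.+1) X i.
  rewrite -(@prod_window _ X _ _ N.+1) ?ltnS //; [|by lia|by lia].
  rewrite [RHS]big_ltn; last by lia.
  rewrite (_ : (if _ then X 1%N else 1) = 1) ?mul1r; last first.
    have level0 : level f 0 = set0 by apply/setP => z; rewrite !inE.
    by case: ifP => // _; rewrite /X size_members /= level0 cards0 big_ord0.
  rewrite [RHS]big_add1; apply: eq_big_nat => j _; case: ifP => // j_in.
  rewrite labelled_mobile_n // -/(last j.+1) /X /=.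
  rewrite -(prod_index (fun m => t j m - last j.+1 - h)) ?members_uniq //.
  by apply: eq_big_seq => p Lp; rewrite labelled_mobile.
have YE : \prod_(1 <= j < N) (if (al < j < be.+1)%N
        then \prod_(q <- level_seq f j.+1)
               (labelled mobile_seq t j n - labelled mobile_seq t j.+1 q) else 1)
  = \prod_(al.+1 <= i < be.+1) Y i.
  rewrite -(@prod_window _ Y _ _ N) ?ltnS //; [|by lia].
  apply: eq_big_nat => j _; case: ifP => // j_in.
  rewrite labelled_mobile_n // -/(last j) /Y /=.
  rewrite -(prod_index (fun m => last j - t j.+1 m)) ?members_uniq //.
  by apply: eq_big_seq => p Lp; rewrite labelled_mobile.
have ZE : \prod_(1 <= j < N) (if (al < j < be.+1)%N
        then \prod_(p <- level_seq f j)
               ((labelled mobile_seq t j n - labelled mobile_seq t j p - h)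
                / (labelled mobile_seq t j n - labelled mobile_seq t j p)) else 1)
  = \prod_(al.+1 <= i < be.+1) Z i.
  rewrite -(@prod_window _ Z _ _ N) ?ltnS //; [|by lia].
  apply: eq_big_nat => j _; case: ifP => // j_in.
  rewrite labelled_mobile_n // -/(last j) /Z /=.
  rewrite -(prod_index (fun m => (last j - t j m - h) / (last j - t j m))) ?members_uniq //.
  by apply: eq_big_seq => p Lp; rewrite labelled_mobile.
rewrite XE YE ZE {XE YE ZE}.
have sizeS j : (al < j < be.+1)%N -> size (level_seq f j) = (psum lam j).-1.
  by move=> j_in; rewrite size_level_seq -[(j <= be)%N]/(j < be.+1)%N j_in subn1.
have sizeO j : ~~ (al < j < be.+1)%N -> size (level_seq f j) = psum lam j.
  move=> /negbTE j_out.
  by rewrite size_level_seq -[(j <= be)%N]/(j < be.+1)%N j_out subn0.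
rewrite /B /=; congr (_ * _); last first.
  by apply: eq_big_nat => i i_in; rewrite /Z sizeS.
rewrite -[LHS]mulrA; congr (_ * _).
  rewrite big_ltn ?ltnS // [RHS]big_ltn ?ltnS //= mulrA; congr (_ * _).
    rewrite /X /= sizeO ?ltnn //; case: (psum lam al) => [|m].
      by rewrite !big_ord0 mulr1.
    by rewrite big_ord_recr mulrC.
  apply: eq_big_nat => i i_in; rewrite /X sizeS //; lia.
rewrite big_nat_recr //= [RHS]big_nat_recr //= mulrCA; congr (_ * _).
  apply: eq_big_nat => i i_in; rewrite /Y sizeS //; lia.
rewrite /Y sizeO ?ltnn ?andbF // -[in RHS](prednK (psum_gt0 (leqW lt_ab))).
by rewrite big_ord_recr mulrC.
Qed.

Variable t0 : assignment K.
Hypothesis t0_distinct : forall j a b, (0 < j < N)%N ->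
  (a < psum lam j)%N -> (b < psum lam j)%N -> a != b -> t0 j a != t0 j b.
Hypothesis two_neq0 : 2%:R != 0 :> K.

(** The composition is the same whichever element is returned to the part al. *)
Lemma reassign_card w : f w = be -> forall k, lam k = #|blocks (reassign f w al) k|.
Proof.
move=> fw k; rewrite lam_f; pose mu := [ffun k => #|blocks f k|] : {ffun 'I_N -> nat}.
have mu_f k' : mu k' = #|blocks f k'| by rewrite ffunE.
have neq_ba : be != al by rewrite neq_ltn lt_ab orbT.
by rewrite -(shift_blocks neq_ba fx mu_f) -(shift_blocks neq_ba fw mu_f).
Qed.

Lemma weight_local pos v v' :
    (forall j q, (0 < j <= N)%N -> q \in mobile_seq j -> v j q = v' j q) ->
  weight h N mobile_seq pos v = weight h N mobile_seq pos v'.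
Proof. by move=> eq_v; apply: eq_label_product. Qed.

Lemma symL_rename w pos : f w = be ->
  symL lam mobile_seq t0 (weight h N mobile_seq pos)
  = Defs.Sym lam (fun t => weight h N mobile_seq pos
      (fun j q => labelled (level_seq (reassign f w al)) t j (rename w q))) t0.
Proof.
move=> fw; apply: (@Sym_relabel _ _ _ _ _ (fun=> rename w)).
- by move=> j _; apply: size_mobile_seq.
- by move=> j _; apply: members_uniq.
- by move=> j _; apply: perm_rename.
- move=> q; rewrite mobile_seq_top => q_in.
  by rewrite rename_lt // /level_seq level_top members_setT.
- exact: weight_local.
Qed.

Lemma symL_start w : f w = be ->
  symL lam mobile_seq t0 (weight h N mobile_seq (position n w.*2.+1))
  = Defs.Sym lam (fun t =>
      (labelled (level_seq (reassign f w al)) t be w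
       - labelled (level_seq (reassign f w al)) t be.+1 w)
      * U h lam (blocks (reassign f w al)) t) t0.
Proof.
move=> fw; rewrite (symL_rename _ fw); apply: Sym_eq => t.
by rewrite weight_start // (U_weight _ _ (reassign_card fw)).
Qed.

Lemma symL_at w : f w = be ->
  symL lam mobile_seq t0 (weight h N mobile_seq (position n w.*2))
  = W h lam (blocks (reassign f w al)) t0.
Proof.
move=> fw; rewrite (symL_rename _ fw); apply: Sym_eq => t.
by rewrite weight_at // (U_weight _ _ (reassign_card fw)).
Qed.

Lemma symL_end :
  symL lam mobile_seq t0 (weight h N mobile_seq (position n n.*2.-1))
  = dcheck h lam al be (U h (shift lam al be) (blocks f)) t0.
Proof. by apply: Sym_eq => t; rewrite dcheck_integrand. Qed.

Lemma symL_cross y : (0 < y)%N ->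
  symL lam mobile_seq t0 (weight h N mobile_seq (position n y.*2.+1))
  - symL lam mobile_seq t0 (weight h N mobile_seq (position n y.*2.-1))
  = if f y == be then h * W h lam (blocks (reassign f y al)) t0 else 0.
Proof.
move=> y_gt0; have neq_ny : n != y by rewrite gtn_eqF.
have uniq_L j : (0 < j < N)%N -> uniq (mobile_seq j) by rewrite mobile_seq_uniq.
have size_L j : (0 < j < N)%N -> size (mobile_seq j) = psum lam j.
  by rewrite size_mobile_seq.
have mem_n j : (0 < j <= N)%N -> (n \in mobile_seq j) = (al.+1 <= j < be.+1)%N.
  by rewrite mem_mobile_n.
have mem_y j : (0 < j <= N)%N -> ((y : nat) \in mobile_seq j) = ((f y).+1 <= j)%N.
  by rewrite mem_mobile_val.
have le_bN := ltn_ord be; have lt_ab1 : (al.+1 < be.+1)%N by [].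
have fy_gt0 : (0 < (f y).+1)%N by [].
case: (ltngtP (f y) be) => [lt_yb|lt_by|eq_yb].
- rewrite -val_eqE /= ltn_eqF //; apply/eqP; rewrite subr_eq0; apply/eqP.
  exact: (symL_weight_cross_below h uniq_L size_L t0_distinct two_neq0 neq_ny
            (mobile_seq_uniq N) (ltn0Sn al) lt_ab1 le_bN fy_gt0 y_gt0 mem_n mem_y).
- rewrite -val_eqE /= gtn_eqF //; apply/eqP; rewrite subr_eq0; apply/eqP.
  apply: Sym_eq => t /=.
  exact: (weight_cross_above h uniq_L two_neq0 neq_ny (mobile_seq_uniq N)
           (ltn0Sn al) lt_ab1 le_bN fy_gt0 y_gt0 mem_n mem_y).
have {}eq_yb : f y = be by apply: val_inj.
rewrite eq_yb eqxx -symL_at // -symL_scale -symL_sub; apply: Sym_eq => t /=.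
apply: (weight_cross_at h uniq_L two_neq0 neq_ny (mobile_seq_uniq N)
           (ltn0Sn al) lt_ab1 le_bN fy_gt0 y_gt0 mem_n mem_y).
by rewrite eq_yb.
Qed.

(** The extra label travels from the gap after w to the far right. *)
Theorem chain_relation w : f w = be ->
  Defs.Sym lam (fun t =>
      (labelled (level_seq (reassign f w al)) t be w
       - labelled (level_seq (reassign f w al)) t be.+1 w)
      * U h lam (blocks (reassign f w al)) t) t0
  = dcheck h lam al be (U h (shift lam al be) (blocks f)) t0
    - h * \sum_(y | (f y == be) && (w < y)%N) W h lam (blocks (reassign f y al)) t0.
Proof.
move=> fw; rewrite -symL_start // -symL_end; apply/esym/eqP.
rewrite subr_eq addrC -subr_eq; apply/eqP.
pose S c := symL lam mobile_seq t0 (weight h N mobile_seq (position n c)).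
rewrite -[LHS](@telescope_sumr _ w.+1 n (fun y : nat => S y.*2.-1)); last exact: ltn_ord.
rewrite big_geq_mkord mulr_sumr [RHS]big_mkcond [LHS]big_mkcond /=.
apply: eq_bigr => y _; case: ifP => lt_wy; rewrite ?andbF // andbT.
by rewrite -symL_cross ?(leq_trans _ lt_wy).
Qed.

End Mobile.

(** * The Pieri relation *)

Section Pieri.
Variables (K : fieldType) (h : K) (N n : nat) (lam : {ffun 'I_N -> nat}).
Variables (f : 'I_n -> 'I_N) (t0 : assignment K).
Hypothesis lam_f : forall k, lam k = #|blocks f k|.
Hypothesis t0_distinct : forall j a b, (0 < j < N)%N ->
  (a < psum lam j)%N -> (b < psum lam j)%N -> a != b -> t0 j a != t0 j b.
Hypothesis two_neq0 : 2%:R != 0 :> K.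
Implicit Type t : assignment K.

Lemma reassignK x (k : 'I_N) : reassign (reassign f x k) x (f x) = f.
Proof. by apply: funext => z; rewrite /reassign; case: eqVneq => // ->. Qed.

Lemma sum_parts k (G : nat -> K) (H : 'I_n -> K) :
    (forall m z, f z = k -> ell (blocks f) k m = val z -> G m = H z) ->
  \sum_(m < lam k) G m = \sum_(z | f z == k) H z.
Proof.
move=> GH; rewrite lam_f.
have -> : \sum_(z | f z == k) H z = \sum_(z in blocks f k) H z.
  by apply: eq_bigl => z; rewrite mem_blocks.
rewrite [RHS]big_enum_val; apply: eq_bigr => m _; apply: GH.
  by have := enum_valP m; rewrite mem_blocks => /eqP.
by rewrite /ell /entry (nth_map (enum_default m)) -?cardE //.
Qed.

Lemma sum_parts_below j (H : 'I_n -> K) :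
  \sum_(k < N | (k < j)%N) \sum_(z | f z == k) H z = \sum_(z in level f j) H z.
Proof.
rewrite [RHS](partition_big f (fun k : 'I_N => (k < j)%N)) => [|z]; last by rewrite inE.
apply: eq_bigr => k lt_kj; apply: eq_bigl => z; rewrite inE.
by case: eqP => [->|_]; rewrite ?lt_kj ?andbF.
Qed.

Lemma sum_level_labels t j :
  \sum_(a < psum lam j) t j a = \sum_(z in level f j) labelled (level_seq f) t j z.
Proof.
rewrite (psum_blocks _ lam_f) [RHS]big_enum_val; apply: eq_bigr => a _.
rewrite /labelled; congr (t j _).
have lt_a : (a < size (enum (level f j)))%N by rewrite -cardE.
by rewrite /level_seq /members [index _ _](index_map val_inj) /enum_val
           index_uniq ?enum_uniq.
Qed.

Lemma labelled_top t (z : 'I_n) : labelled (level_seq f) t N z = t N z.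
Proof.
rewrite /labelled /level_seq level_top members_setT; congr (t N _).
rewrite -{1}[val z]add0n -(nth_iota 0 0 (ltn_ord z)).
by rewrite index_uniq ?iota_uniq ?size_iota.
Qed.

(** The chain of an element of part i is followed from level i + 1 up to level N,
    the chains of the elements of earlier parts from level i to level i + 1. *)
Lemma multiplier_telescope (i : 'I_N) t : (i.+1 < N)%N ->
  \sum_(a < psum lam i.+1) t i.+1 a - \sum_(a < psum lam i) t i a
    - \sum_(x in blocks f i) t N x
  = \sum_(x | f x == i) \sum_(b < N | (i < b)%N)
      (labelled (level_seq f) t b x - labelled (level_seq f) t b.+1 x)
    - \sum_(a < N | (a < i)%N) \sum_(x | f x == a)
      (labelled (level_seq f) t i x - labelled (level_seq f) t i.+1 x).
Proof.
move=> lt_iN; rewrite !sum_level_labels.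
set V := labelled (level_seq f) t.
have -> : \sum_(x in blocks f i) t N x = \sum_(x | f x == i) V N x.
  by apply: eq_big => [x|x _]; rewrite ?mem_blocks // /V labelled_top.
have -> : \sum_(z in level f i.+1) V i.+1 z
        = \sum_(z in level f i) V i.+1 z + \sum_(z | f z == i) V i.+1 z.
  rewrite (bigID (fun z => z \in level f i)) /=; congr (_ + _); apply: eq_bigl => z.
    by rewrite !inE; lia.
  by rewrite !inE -val_eqE /=; lia.
have -> : \sum_(x | f x == i) \sum_(b < N | (i < b)%N) (V b x - V b.+1 x)
        = \sum_(x | f x == i) V i.+1 x - \sum_(x | f x == i) V N x.
  rewrite -sumrB; apply: eq_bigr => x _.
  rewrite -(big_geq_mkord _ _ xpredT (fun b => V b x - V b.+1 x)).
  rewrite -[RHS]opprB -(telescope_sumr (fun b => V b x) (ltnW lt_iN)) -sumrN.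
  by apply: eq_bigr => b _; rewrite opprB.
rewrite sum_parts_below sumrB.
by ring.
Qed.

(** This is [chain_relation] for the partition in which x has moved from a to
    b: returning x to a restores f, and returning y instead gives the
    exchange. *)
Lemma block_relation (a b : 'I_N) x : (a < b)%N -> f x = a ->
  Defs.Sym lam (fun t =>
      (labelled (level_seq f) t b x - labelled (level_seq f) t b.+1 x)
      * U h lam (blocks f) t) t0
  = dcheck h lam a b (U h (shift lam a b) (blocks (reassign f x b))) t0
    - h * \sum_(y | (f y == b) && (x < y)%N)
            W h lam (blocks (reassign (reassign f x b) y a)) t0.
Proof.
move=> lt_ab fx; pose g := reassign f x b.
have gx : g x = b by rewrite /g /reassign eqxx.
have eq_f : reassign g x a = f by rewrite -fx reassignK.
have lam_g k : lam k = #|blocks (reassign g x a) k| by rewrite eq_f.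
have := @chain_relation _ h _ _ _ _ _ _ _ lt_ab gx lam_g _ t0_distinct two_neq0 x gx.
rewrite eq_f => ->; congr (_ - h * _); apply: eq_bigl => y.
rewrite /g /reassign; case: (eqVneq y x) => // ->.
by rewrite ltnn !andbF.
Qed.

Theorem pieri_relation (i : 'I_N) : (i.+1 < N)%N ->
  (\sum_(a < psum lam i.+1) t0 i.+1 a - \sum_(a < psum lam i) t0 i a
     - \sum_(x in blocks f i) t0 N x) * W h lam (blocks f) t0
  = h * (\sum_(j < N | (j < i)%N) \sum_(m1 < lam i)
           \sum_(m2 < lam j | (ell (blocks f) j m2 < ell (blocks f) i m1)%N)
             W h lam (exchange (blocks f) i j m1 m2) t0)
    - h * (\sum_(j < N | (i < j)%N) \sum_(m1 < lam i)
             \sum_(m2 < lam j | (ell (blocks f) i m1 < ell (blocks f) j m2)%N)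
               W h lam (exchange (blocks f) i j m1 m2) t0)
    + \sum_(j < N | (i < j)%N) \sum_(a < lam i)
        dcheck h lam i j (U h (shift lam i j) (move (blocks f) i j a)) t0
    - \sum_(j < N | (j < i)%N) \sum_(a < lam j)
        dcheck h lam j i (U h (shift lam j i) (move (blocks f) j i a)) t0.
Proof.
move=> lt_iN.
pose E x y (a b : 'I_N) := W h lam (blocks (reassign (reassign f x b) y a)) t0.
pose D x (a b : 'I_N) :=
  dcheck h lam a b (U h (shift lam a b) (blocks (reassign f x b))) t0.
have exchangeE (a b : 'I_N) m1 m2 x y : a != b -> f x = a -> f y = b ->
    ell (blocks f) a m1 = val x -> ell (blocks f) b m2 = val y ->
    W h lam (exchange (blocks f) a b m1 m2) t0 = E x y a b.
  by move=> neq_ab fx fy ex ey; rewrite (exchange_blocks neq_ab fx fy ex ey).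
have moveE (a b : 'I_N) : a != b ->
    \sum_(m < lam a) dcheck h lam a b (U h (shift lam a b) (move (blocks f) a b m)) t0
    = \sum_(x | f x == a) D x a b.
  move=> neq_ab; apply: (@sum_parts _ (fun m =>
    dcheck h lam a b (U h (shift lam a b) (move (blocks f) a b m)) t0)) => m x fx ex.
  by rewrite (move_blocks neq_ab fx ex).
have -> : \sum_(j < N | (i < j)%N) \sum_(m1 < lam i)
      \sum_(m2 < lam j | (ell (blocks f) i m1 < ell (blocks f) j m2)%N)
        W h lam (exchange (blocks f) i j m1 m2) t0
  = \sum_(j < N | (i < j)%N) \sum_(x | f x == i)
      \sum_(y | (f y == j) && (x < y)%N) E x y i j.
  apply: eq_bigr => j lt_ij; have neq_ij : i != j by rewrite neq_ltn lt_ij.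
  apply: (@sum_parts _ (fun m1 =>
      \sum_(m2 < lam j | (ell (blocks f) i m1 < ell (blocks f) j m2)%N)
        W h lam (exchange (blocks f) i j m1 m2) t0)) => m1 x fx ex.
  rewrite big_mkcond [RHS]big_mkcondr.
  apply: (@sum_parts _ (fun m2 => if (ell (blocks f) i m1 < ell (blocks f) j m2)%N
     then W h lam (exchange (blocks f) i j m1 m2) t0 else 0)) => m2 y fy ey.
  by rewrite ex ey (exchangeE _ _ _ _ x y).
have -> : \sum_(j < N | (j < i)%N) \sum_(m1 < lam i)
      \sum_(m2 < lam j | (ell (blocks f) j m2 < ell (blocks f) i m1)%N)
        W h lam (exchange (blocks f) i j m1 m2) t0
  = \sum_(j < N | (j < i)%N) \sum_(x | f x == j)
      \sum_(y | (f y == i) && (x < y)%N) E x y j i.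
  apply: eq_bigr => j lt_ji; have neq_ij : i != j by rewrite neq_ltn lt_ji orbT.
  transitivity (\sum_(y | f y == i) \sum_(x | f x == j)
                  if (x < y)%N then E x y j i else 0).
    apply: (@sum_parts _ (fun m1 =>
        \sum_(m2 < lam j | (ell (blocks f) j m2 < ell (blocks f) i m1)%N)
          W h lam (exchange (blocks f) i j m1 m2) t0)) => m1 y fy ey.
    rewrite big_mkcond.
    apply: (@sum_parts _ (fun m2 => if (ell (blocks f) j m2 < ell (blocks f) i m1)%N
       then W h lam (exchange (blocks f) i j m1 m2) t0 else 0)) => m2 x fx ex.
    rewrite ex ey (exchangeE _ _ _ _ y x) //; case: ifP => // lt_xy.
    congr (W h lam (blocks _) t0); apply: funext => z; rewrite /reassign.
    case: (eqVneq z x) => [->|//]; case: (eqVneq x y) => // eq_xy.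
    by rewrite eq_xy ltnn in lt_xy.
  rewrite exchange_big; apply: eq_bigr => x _.
  by rewrite [RHS]big_mkcondr.
under [X in _ = _ + X - _]eq_bigr => j lt_ij do rewrite moveE ?neq_ltn ?lt_ij //.
under [X in _ = _ - X]eq_bigr => j lt_ji do rewrite moveE ?neq_ltn ?lt_ji //.
pose phi t := \sum_(a < psum lam i.+1) t i.+1 a - \sum_(a < psum lam i) t i a
                - \sum_(x in blocks f i) t N x.
rewrite -/(phi t0) -(Sym_mul_invariant (c := phi)) => [|j s t /andP[_ lt_jN]]; last first.
  have level_inv m : \sum_(a < psum lam m) permute j s t m a = \sum_(a < psum lam m) t m a.
    by apply: sum_level_permute; case: eqVneq => //= ->.
  rewrite /phi !level_inv; congr (_ - _); apply: eq_bigr => x _.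
  by rewrite /permute gtn_eqF.
transitivity (Defs.Sym lam (fun t =>
     (\sum_(x | f x == i) \sum_(b < N | (i < b)%N)
        (labelled (level_seq f) t b x - labelled (level_seq f) t b.+1 x)
        * U h lam (blocks f) t)
     - (\sum_(a < N | (a < i)%N) \sum_(x | f x == a)
        (labelled (level_seq f) t i x - labelled (level_seq f) t i.+1 x)
        * U h lam (blocks f) t)) t0).
  apply: Sym_eq => t; rewrite /phi multiplier_telescope // mulrBl !mulr_suml.
  by congr (_ - _); apply: eq_bigr => ? _; rewrite mulr_suml.
rewrite Sym_add Sym_opp !Sym_sum.
have upper : \sum_(x | f x == i) Defs.Sym lam (fun t => \sum_(b < N | (i < b)%N)
        (labelled (level_seq f) t b x - labelled (level_seq f) t b.+1 x)
        * U h lam (blocks f) t) t0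
  = \sum_(j < N | (i < j)%N) \sum_(x | f x == i) D x i j
    - h * (\sum_(j < N | (i < j)%N) \sum_(x | f x == i)
             \sum_(y | (f y == j) && (x < y)%N) E x y i j).
  under eq_bigr do rewrite Sym_sum.
  rewrite exchange_big mulr_sumr -sumrB; apply: eq_bigr => j lt_ij.
  rewrite mulr_sumr -sumrB; apply: eq_bigr => x /eqP fx.
  exact: block_relation.
have lower : \sum_(a < N | (a < i)%N) Defs.Sym lam (fun t => \sum_(x | f x == a)
        (labelled (level_seq f) t i x - labelled (level_seq f) t i.+1 x)
        * U h lam (blocks f) t) t0
  = \sum_(j < N | (j < i)%N) \sum_(x | f x == j) D x j i
    - h * (\sum_(j < N | (j < i)%N) \sum_(x | f x == j)
             \sum_(y | (f y == i) && (x < y)%N) E x y j i).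
  rewrite mulr_sumr -sumrB; apply: eq_bigr => j lt_ij.
  rewrite Sym_sum mulr_sumr -sumrB; apply: eq_bigr => x /eqP fx.
  exact: block_relation.
rewrite upper lower; ring.
Qed.

End Pieri.

(** * Generic variables *)

Lemma tvar_distinct (F : fieldType) (N : nat) (lam : {ffun 'I_N -> nat}) j a b :
    (0 < j < N)%N -> (a < psum lam j)%N -> (b < psum lam j)%N -> a != b ->
  tvar F lam j a != tvar F lam j b.
Proof.
case/andP=> _ lt_jN lt_a lt_b neq_ab.
rewrite /tvar (insubT (fun j => j < N.+1)%N (leqW lt_jN)) /=.
rewrite (insubT (fun a => a < psum lam j)%N lt_a).
rewrite (insubT (fun a => a < psum lam j)%N lt_b).
rewrite tofrac_eq; apply: contra neq_ab => /eqP eq_X.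
set va := enum_rank _ in eq_X; set vb := enum_rank _ in eq_X.
have /eqP := congr1 (mcoeff U_(va)%MM) eq_X.
rewrite !mcoeffXU eqxx [vb == va]eq_sym.
case: (eqVneq va vb) => [/enum_rank_inj eq_ab _|_].
  by move/eqP: eq_ab; rewrite eq_Tagged /= -val_eqE.
by rewrite oner_eq0.
Qed.

Lemma two_neq0_fraction (R : realType) m : 2%:R != 0 :> {fraction {mpoly R[i][m]}}.
Proof.
rewrite -(rmorph_nat (@tofrac _)) tofrac_eq0 -mpolyC_nat mpolyC_eq0.
by rewrite Num.Theory.pnatr_eq0.
Qed.


Theorem theorem4p4 (R : realType) (N n : nat) (hN : (0 < N)%N) (hn : (0 < n)%N)
    (h0 : R[i]) (h0_neq0 : h0 != 0)
    (lam : {ffun 'I_N -> nat}) (lam_sum : (\sum_k lam k = n)%N)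
    (I : {ffun 'I_N -> {set 'I_n}}) (hI : ordered_partition lam I)
    (i : 'I_N) (hi : (i.+1 < N)%N) :
  let t := tvar R[i] lam in
  let h := ratconst lam h0 in
  (\sum_(a < psum lam i.+1) t i.+1 a - \sum_(a < psum lam i) t i a
     - \sum_(x in I i) t N x) * W h lam I t
  = h * (\sum_(j < N | (j < i)%N) \sum_(m1 < lam i)
           \sum_(m2 < lam j | (ell I j m2 < ell I i m1)%N)
             W h lam (exchange I i j m1 m2) t)
    - h * (\sum_(j < N | (i < j)%N) \sum_(m1 < lam i)
             \sum_(m2 < lam j | (ell I i m1 < ell I j m2)%N)
               W h lam (exchange I i j m1 m2) t)
    + \sum_(j < N | (i < j)%N) \sum_(a < lam i)
        dcheck h lam i j (U h (shift lam i j) (move I i j a)) t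
    - \sum_(j < N | (j < i)%N) \sum_(a < lam j)
        dcheck h lam j i (U h (shift lam j i) (move I j i a)) t.
Proof.
have [f [-> lam_f]] := ordered_partition_blocks hI.
apply: pieri_relation => //; first by move=> *; apply: tvar_distinct.
exact: two_neq0_fraction.
Qed.
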